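(* Let $Ax^2+Bx$ be an integer valued polynomial with $A>B\ge 0$, let $k\ge 1$ be an integer, and let $Z=\{z_1,z_2,z_3,z_4,z_5\}$ be a set of five pairwise coprime positive integers. Let $G_1,G_2,\ldots,G_{12}$ be the explicit real polynomials in the variable $l$ (with coefficients depending on $A,B,k,z_1,z_2,z_3,z_4,z_5$) given in the context, and put $$L_{Z,A,B}^k=\lceil \mathcal{T}_l\{G_1,G_2,\ldots,G_{12}\}\rceil .$$ Then $\gamma_{Z,A,B}^k(n)\ge 0$ for all integers $$n\ge N_{Z,A,B}^k=A\left(k+2L_{Z,A,B}^k\right)^2+B\left(k+2L_{Z,A,B}^k\right).$$
   Context: For a finite set $S$ of pairwise coprime positive integers, an integer valued polynomial $Ax^2+Bx$ (i.e. taking integer values at integers) with real $A>B\ge 0$, and integers $k\ge 1$, $n\ge 0$, the coefficients $\gamma_{S,A,B}^k(n)$ are defined by the formal power series identity $$\prod_{s\in S}\frac{1}{1-q^s}\sum_{j\not\in[-k,k-1]}(-1)^{j+k}q^{Aj^2+Bj}=\sum_{n=0}^{\infty}\gamma_{S,A,B}^k(n)q^n,$$ where the sum is over all integers $j\le -k-1$ and $j\ge k$. For a real polynomial $G(x)$, $\mathcal{R}_xG(x)$ is the set of all real roots of $G(x)$. For real polynomials $G_1(x),\ldots,G_m(x)$, $$\mathcal{T}_x\{G_1(x),\ldots,G_m(x)\}=\max\left(\{1\}\cup\mathcal{R}_xG_1(x)\cup\cdots\cup\mathcal{R}_xG_m(x)\right).$$ $\lceil x\rceil$ is the smallest integer $\ge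 x$. Constants: with $\sigma=z_1z_2+z_1z_3+z_1z_4+z_1z_5+z_2z_3+z_2z_4+z_2z_5+z_3z_4+z_3z_5+z_4z_5$, $$a=\frac{1}{24z_1z_2z_3z_4z_5},\qquad b=\frac{z_1+z_2+z_3+z_4+z_5}{12z_1z_2z_3z_4z_5},$$ $$c=\frac{z_1^2+z_2^2+z_3^2+z_4^2+z_5^2}{24z_1z_2z_3z_4z_5}+\frac{\sigma}{8z_1z_2z_3z_4z_5},\qquad d=\frac{(z_1+z_2+z_3+z_4+z_5)\,\sigma}{24z_1z_2z_3z_4z_5},$$ and $e=D_{z_1,z_2,z_3,z_4,z_5}$, defined as follows. Let $t(n)$ ($n\ge 0$) be defined by $$\frac{1}{(1-q^{z_1})(1-q^{z_2})(1-q^{z_3})(1-q^{z_4})(1-q^{z_5})}=\sum_{n\ge 0}(an^4+bn^3+cn^2+dn)q^n+\sum_{n\ge 0}t(n)q^n;$$ it is known that $t(n)$ is periodic in $n$ with period $z_1z_2z_3z_4z_5$, and $D_{z_1,z_2,z_3,z_4,z_5}$ is the smallest real number with $|t(n)|\le D_{z_1,z_2,z_3,z_4,z_5}$ for all integers $n\ge 0$. The polynomials in $l$: \begin{align*} G_1=&48a(A-B)(2Ak-A-B)l^2+24a(2k+1)(A-B)(2Ak-A-B)l+\frac{8ac-3b^2}{4a},\\ G_2=&192A^2ak(A-B)l^4+64a(A-B)(6A^2k^2+3ABk+A^2+AB-2B^2)l^3\\ &+24(A-B)(8A^2ak^3+12ABak^2+6A^2ak+6ABak-6B^2ak-2ABa+Abk-2B^2a\\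 &-Bb)l^2+2(A-B)(48ABak^3+48A^2ak^2+48ABak^2-24B^2ak^2-12ABak+12Abk^2\\ &-12B^2ak-12A^2a-12ABa-6Bbk-3Ab-3Bb-2c)l+d,\\ G_3=&256A^3ak(A-B)l^6+384A^2ak(A-B)(2Ak+B)l^5+16(A-B)(48A^3ak^3\\ &+60A^2Bak^2+6A^3ak+6A^2Bak+12AB^2ak+8A^2Ba+3A^2bk+8AB^2a-8B^3a)l^4\\ &+16(A-B)(16A^3ak^4+48A^2Bak^3+12A^3ak^2+12A^2Bak^2+24AB^2ak^2+22A^2Bak\\ &+6A^2bk^2+22AB^2ak-14B^3ak+8A^3a+8A^2Ba-4AB^2a+3ABbk-4B^3a+A^2b\\ &+ABb-2B^2b)l^3+4(A-B)(48A^2Bak^4+16A^3ak^3+16A^2Bak^3+64AB^2ak^3\\ &+84A^2Bak^2+12A^2bk^3+84AB^2ak^2-36B^3ak^2+60A^3ak+60A^2Bak-18AB^2ak\\ &+18ABbk^2-18B^3ak-12A^2Ba+9A^2bk-12AB^2a+9ABbk-9B^2bk-3ABb\\ &+2Ack-3B^2b-2Bc)l^2+(-32A^4ak^4+96A^2B^2ak^4-64AB^3ak^4+96A^3Bak^3\\ &-128AB^3ak^3+32B^4ak^3+144A^4ak^2-168A^2B^2ak^2+24A^2Bbk^3-24AB^2bk^3\\ &+24B^4ak^2-24A^3Bak+24A^3bk^2+24AB^3ak-36AB^2bk^2+12B^3bk^2-34A^4a\\ &+36A^2B^2a-6A^2Bbk+8A^2ck^2-8ABck^2-2B^4a+6B^3bk-6A^3b+6AB^2b-4ABck\\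 &+4B^2ck-2A^2c+2B^2c-2Ad+2Bd-4e)l-e,\\ G_4=&192A^2ak(A-B)l^4+32a(A-B)(9A^2k^2+12A^2k-2A^2-2AB+B^2)l^3\\ &+48a(A-B)(2A^2k^3+9A^2k^2+4A^2k-2ABk+B^2k-2A^2-2AB+B^2)l^2\\ &+((A-B)(192A^2a^2k^3+336A^2a^2k^2-96ABa^2k^2+48B^2a^2k^2-192ABa^2k\\ &+96B^2a^2k-60A^2a^2-72ABa^2+36B^2a^2+8ac-3b^2)l)/(2a)\\ &+((2k+1)(A-B)(16A^2a^2k^2-32ABa^2k^2+16B^2a^2k^2+16A^2a^2k-32ABa^2k\\ &+16B^2a^2k+4A^2a^2-8ABa^2+4B^2a^2+8ac-3b^2))/(4a),\\ G_5=&256A^3ak(A-B)l^6+384A^2ak(A-B)(2kA+2A-B)l^5\\ &+16(A-B)(48A^3ak^3+120A^3ak^2-60A^2Bak^2+66A^3ak-54A^2Bak+12AB^2ak\\ &+8A^2Ba+3A^2bk+8AB^2a-8B^3a)l^4+16(A-B)(16A^3ak^4+96A^3ak^3-48A^2Bak^3\\ &+132A^3ak^2-108A^2Bak^2+24AB^2ak^2+52A^3ak-38A^2Bak+6A^2bk^2+34AB^2ak\\ &-18B^3ak-8A^3a+8A^2Ba+6A^2bk+20AB^2a-3ABbk-12B^3a-A^2b-ABb\\ &+2B^2b)l^3+4(A-B)(96A^3ak^4-48A^2Bak^4+304A^3ak^3-272A^2Bak^3+64AB^2ak^3\\ &+312A^3ak^2-276A^2Bak^2+12A^2bk^3+156AB^2ak^2-60B^3ak^2+60A^3ak-60A^2Bak\\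 &+36A^2bk^2+162AB^2ak-18ABbk^2-78B^3ak-48A^3a-12A^2Ba+15A^2bk+60AB^2a\\ &-21ABbk-24B^3a+15B^2bk-6A^2b-9ABb+2Ack+9B^2b-2Bc)l^2+(160A^4ak^4\\ &-384A^3Bak^4+288A^2B^2ak^4-64AB^3ak^4+448A^4ak^3-928A^3Bak^3+768A^2B^2ak^3\\ &-384AB^3ak^3+96B^4ak^3+336A^4ak^2-672A^3Bak^2+48A^3bk^3+744A^2B^2ak^2-72A^2Bbk^3\\ &-576AB^3ak^2+24AB^2bk^3+168B^4ak^2-48A^4ak-120A^3Bak+72A^3bk^2+432A^2B^2ak\\ &-144A^2Bbk^2-360AB^3ak+108AB^2bk^2+96B^4ak-36B^3bk^2-62A^4a+16A^3Ba+12A^3bk\\ &+108A^2B^2a-78A^2Bbk+8A^2ck^2-80AB^3a+108AB^2bk-8ABck^2+18B^4a-42B^3bk\\ &-6A^3b-12A^2Bb+8A^2ck+30AB^2b-20ABck-12B^3b+12B^2ck+2A^2c-8ABc+6B^2c\\ &+2Ad-2Bd-4e)l+a(A-B)^4(2k+1)^4+b(A-B)^3(2k+1)^3\\ &+c(A-B)^2(2k+1)^2+d(A-B)(2k+1)-2e,\\ G_6=&96a(A-B)(Ak+B)l^2+12(A-B)(8Aak^2+8Aak+12Bak+2Aa+10Ba+b)l\\ &+48A^2ak^2-48B^2ak^2+48A^2ak+48ABak-96B^2ak+12A^2a+24ABa+12Abk\\ &-36B^2a-12Bbk+6Ab-6Bb-2c,\\ G_7=&96a(A-B)(Ak+B)l^2+12(A-B)(8Aak^2+16Aak+4Bak-2Aa+14Ba-b)l\\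 &+96A^2ak^2-96ABak^2+96A^2ak-48ABak-48B^2ak-24A^2a+96ABa-72B^2a\\ &-12Ab+12Bb-2c, \end{align*} \begin{align*} G_8=&192A^2ak(A-B)l^4+64a(A-B)(6A^2k^2+6A^2k+3ABk-A^2-BA+2B^2)l^3\\ &+24(A-B)(8A^2ak^3+24A^2ak^2+12ABak^2+10A^2ak+10ABak+10B^2ak-4A^2a\\ &-2ABa+Abk+10B^2a+Bb)l^2+2(A-B)(96A^2ak^3+48ABak^3+144A^2ak^2\\ &+144ABak^2+72B^2ak^2+24A^2ak+84ABak+12Abk^2+156B^2ak-12A^2a+12ABa\\ &+12Abk+72B^2a+18Bbk+3Ab+15Bb+2c)l+32A^3ak^3-32B^3ak^3+48A^3ak^2\\ &+48A^2Bak^2-96B^3ak^2+24A^3ak+48A^2Bak+12A^2bk^2+24AB^2ak-96B^3ak\\ &-12B^2bk^2+4A^3a+12A^2Ba+12A^2bk+12AB^2a+12ABbk-28B^3a-24B^2bk\\ &+3A^2b+6ABb+4Ack-9B^2b-4Bck+2Ac-2Bc-d,\\ G_9=&256A^3ak(A-B)l^6+384A^2ak(A-B)(2Ak+2A+B)l^5\\ &+16(A-B)(48A^3ak^3+120A^3ak^2+60A^2Bak^2+66A^3ak+66A^2Bak+12AB^2ak\\ &-8A^2Ba+3A^2bk-8AB^2a+8B^3a)l^4+16(A-B)(16A^3ak^4+96A^3ak^3+48A^2Bak^3\\ &+132A^3ak^2+132A^2Bak^2+24AB^2ak^2+52A^3ak+62A^2Bak+6A^2bk^2+14AB^2ak\\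 &+18B^3ak-8A^3a-24A^2Ba+6A^2bk-12AB^2a+3ABbk+20B^3a-A^2b-ABb\\ &+2B^2b)l^3+4(A-B)(96A^3ak^4+48A^2Bak^4+304A^3ak^3+304A^2Bak^3+64AB^2ak^3\\ &+312A^3ak^2+420A^2Bak^2+12A^2bk^3+132AB^2ak^2+60B^3ak^2+60A^3ak+60A^2Bak\\ &+36A^2bk^2+42AB^2ak+18ABbk^2+138B^3ak-48A^3a-84A^2Ba+15A^2bk-12AB^2a\\ &+15ABbk+72B^3a+15B^2bk-6A^2b-3ABb+2Ack+15B^2b+2Bc)l^2+(160A^4ak^4\\ &-96A^2B^2ak^4-64AB^3ak^4+448A^4ak^3+160A^3Bak^3-384A^2B^2ak^3-128AB^3ak^3\\ &-96B^4ak^3+336A^4ak^2+192A^3Bak^2+48A^3bk^3-216A^2B^2ak^2-24A^2Bbk^3-24AB^2bk^3\\ &-312B^4ak^2-48A^4ak+24A^3Bak+72A^3bk^2+192A^2B^2ak+168AB^3ak-36AB^2bk^2\\ &-336B^4ak-36B^3bk^2-62A^4a-16A^3Ba+12A^3bk+108A^2B^2a+30A^2Bbk+8A^2ck^2\\ &+80AB^3a+36AB^2bk-8ABck^2-110B^4a-78B^3bk-6A^3b+12A^2Bb+8A^2ck\\ &+30AB^2b+4ABck-36B^3b-12B^2ck+2A^2c+8ABc-10B^2c+2Ad-2Bd-4e)l\\ &+16A^4ak^4-16B^4ak^4+32A^4ak^3+32A^3Bak^3-64B^4ak^3+24A^4ak^2+48A^3Bak^2\\ &+8A^3bk^3+24A^2B^2ak^2-96B^4ak^2-8B^3bk^3+8A^4ak+24A^3Bak+12A^3bk^2+24A^2B^2ak\\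 &+12A^2Bbk^2+8AB^3ak-64B^4ak-24B^3bk^2+A^4a+4A^3Ba+6A^3bk+6A^2B^2a+12A^2Bbk\\ &+4A^2ck^2+4AB^3a+6AB^2bk-15B^4a-24B^3bk-4B^2ck^2+A^3b+3A^2Bb+4A^2ck\\ &+3AB^2b+4ABck-7B^3b-8B^2ck+A^2c+2ABc+2Adk-3B^2c-2Bdk+Ad-Bd-3e, \end{align*} \begin{align*} G_{10}=&192A^2ak(A-B)l^4+64a(A-B)(6A^2k^2+12A^2k-3ABk+A^2+BA-2B^2)l^3\\ &+24(A-B)(8A^2ak^3+48A^2ak^2-12ABak^2+54A^2ak-18ABak-6B^2ak\\ &+8A^2a+10ABa+Abk-14B^2a+Bb)l^2+2(A-B)(192A^2ak^3-48ABak^3+624A^2ak^2\\ &-240ABak^2-24B^2ak^2+528A^2ak-132ABak+12Abk^2-132B^2ak+84A^2a+132ABa\\ &+24Abk-144B^2a+6Bbk-3Ab+21Bb-2c)l+2(A-B)(96A^2ak^3-48ABak^3\\ &+240A^2ak^2-96ABak^2-24B^2ak^2+168A^2ak-12ABak+12Abk^2-60B^2ak+20A^2a\\ &+44ABa+12Abk-40B^2a+6Bbk-3Ab+9Bb-2c),\\ G_{11}=&192A^2ak(A-B)l^4+64a(A-B)(6A^2k^2+12A^2k+3ABk+A^2+BA-2B^2)l^3\\ &+24(A-B)(8A^2ak^3+48A^2ak^2+12ABak^2+54A^2ak+30ABak-6B^2ak+8A^2a\\ &+6ABa+Abk-18B^2a-Bb)l^2+2(A-B)(192A^2ak^3+48ABak^3+624A^2ak^2\\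 &+336ABak^2-24B^2ak^2+528A^2ak+420ABak+12Abk^2-156B^2ak+84A^2a+36ABa\\ &+24Abk-240B^2a-6Bbk-3Ab-27Bb-2c)l+2(A-B)(96A^2ak^3+48ABak^3\\ &+240A^2ak^2+192ABak^2-24B^2ak^2+168A^2ak+156ABak+12Abk^2-84B^2ak\\ &+20A^2a-4ABa+12Abk-88B^2a-6Bbk-3Ab-15Bb-2c),\\ G_{12}=&256A^3ak(A-B)l^6+384A^2ak(A-B)(2Ak+4A-B)l^5\\ &+16(A-B)(48A^3ak^3+240A^3ak^2-60A^2Bak^2+246A^3ak-114A^2Bak+12AB^2ak\\ &-8A^2Ba+3A^2bk-8AB^2a+8B^3a)l^4+16(A-B)(16A^3ak^4+192A^3ak^3-48A^2Bak^3\\ &+492A^3ak^2-228A^2Bak^2+24AB^2ak^2+344A^3ak-238A^2Bak+6A^2bk^2+26AB^2ak\\ &+14B^3ak+8aA^3-24A^2Ba+12A^2bk-36AB^2a-3ABbk+28B^3a+A^2b+ABb\\ &-2B^2b)l^3+4(A-B)(192A^3ak^4-48A^2Bak^4+1168A^3ak^3-560A^2Bak^3+64AB^2ak^3\\ &+2064A^3ak^2-1380A^2Bak^2+12A^2bk^3+204AB^2ak^2+36B^3ak^2+1164A^3ak\\ &-1020A^2Bak+72A^2bk^2+6AB^2ak-18ABbk^2+150B^3ak+96aA^3-84A^2Ba\\ &+81A^2bk-228AB^2a-27ABbk+144B^3a-9B^2bk+12A^2b+15ABb+2Ack-21B^2b\\ &+2Bc)l^2+(736A^4ak^4-1152A^3Bak^4+480A^2B^2ak^4-64AB^3ak^4+3200A^4ak^3\\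 &-5472A^3Bak^3+2688A^2B^2ak^3-384AB^3ak^3-32B^4ak^3+4560A^4ak^2-8352A^3Bak^2\\ &+96A^3bk^3+4248A^2B^2ak^2-120A^2Bbk^3-192AB^3ak^2+24AB^2bk^3-264B^4ak^2\\ &+2400A^4ak-4488A^3Bak+312A^3bk^2+1680A^2B^2ak-432A^2Bbk^2+936AB^3ak\\ &+108AB^2bk^2-528B^4ak+12B^3bk^2+350A^4a-416A^3Ba+264A^3bk-540A^2B^2a\\ &-330A^2Bbk+8A^2ck^2+928AB^3a-8ABck^2-322B^4a+66B^3bk+42A^3b+24A^2Bb\\ &+16A^2ck-138AB^2b-12ABck+72B^3b-4B^2ck-2A^2c+16ABc-14B^2c-2Ad\\ &+2Bd-4e)l+224A^4ak^4-448A^3Bak^4+288A^2B^2ak^4-64AB^3ak^4+832A^4ak^3\\ &-1632A^3Bak^3+960A^2B^2ak^3-128AB^3ak^3-32B^4ak^3+1104A^4ak^2-2064A^3Bak^2\\ &+48A^3bk^3+984A^2B^2ak^2-72A^2Bbk^3+96AB^3ak^2+24AB^2bk^3-120B^4ak^2+592A^4ak\\ &-968A^3Bak+120A^3bk^2+168A^2B^2ak-168A^2Bbk^2+360AB^3ak+36AB^2bk^2-152B^4ak\\ &+12B^3bk^2+94A^4a-80A^3Ba+84A^3bk-156A^2B^2a-90A^2Bbk+8A^2ck^2+208AB^3a\\ &-24AB^2bk-8ABck^2-66B^4a+30B^3bk+10A^3b+12A^2Bb+8A^2ck-42AB^2b-4ABck\\ &+20B^3b-4B^2ck-2A^2c+8ABc-6B^2c-2Ad+2Bd-4e.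 \end{align*} *)

(* Defs.v *)
From HB Require Import structures.
From mathcomp Require Import all_boot all_order all_algebra finmap.
From mathcomp Require Import polyrcf zify.
From mathcomp Require Import all_classical all_reals.

Set Implicit Arguments.
Unset Strict Implicit.
Unset Printing Implicit Defensive.

Import Order.TTheory GRing.Theory Num.Theory.
Local Open Scope classical_set_scope.
Local Open Scope ring_scope.

(* Formal power series with integer coefficients: f n is the coefficient of
   q^n, and the product is the Cauchy product. *)
Definition fps := nat -> int.

Definition fps_one : fps := fun n => (n == 0%N)%:R.

Definition fps_mul (f g : fps) : fps :=
  fun n => \sum_(i < n.+1) f i * g (n - i)%N.

Definition fps_1subX (s : nat) : fps := fun n => (n == 0%N)%:R - (n == s)%:R.

(* 1 / (1 - q^s) = 1 + q^s + q^(2s) + ..., see fps_geomP. *)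
Definition fps_geom (s : nat) : fps := fun n => (s %| n)%N%:R.

Lemma fps_geomP (s : nat) :
  (0 < s)%N -> fps_mul (fps_1subX s) (fps_geom s) = fps_one.
Proof.
move=> s_gt0; apply/funext => n; rewrite /fps_mul /fps_1subX /fps_geom /fps_one.
under eq_bigr do rewrite mulrBl.
rewrite sumrB (bigD1 ord0) //= mul1r subn0 big1 ?addr0; last first.
  by move=> i; rewrite -val_eqE /= => /negPf ->; rewrite mul0r.
have [s_le|n_lt] := leqP s n.
  have s_lt : (s < n.+1)%N by [].
  rewrite (bigD1 (Ordinal s_lt)) //= eqxx mul1r big1 ?addr0; last first.
    by move=> i; rewrite -val_eqE /= => /negPf ->; rewrite mul0r.
  have -> : (s %| n - s)%N = (s %| n)%N by rewrite dvdn_subl.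
  rewrite subrr; case: n s_le {s_lt} => //; by case: (s) s_gt0.
rewrite big1 => [|i _].
  rewrite subr0; case: n n_lt => [|n] n_lt; first by rewrite dvdn0.
  by rewrite gtnNdvd.
by rewrite ltn_eqF ?mul0r // (leq_trans _ n_lt) // ltnS -ltnS.
Qed.

Definition part_series (S : {fset nat}) : fps :=
  \big[fps_mul/fps_one]_(s <- S) fps_geom s.

Section TailSeries.
Variables (R : realType) (A B : R).

Definition quad (x : R) : R := A * x ^+ 2 + B * x.

Definition integer_valued : Prop :=
  forall x : int, quad x%:~R \is a Num.int.

Definition tail_exponents (k m : nat) : set int :=
  [set j : int | ~ (- k%:Z <= j <= k%:Z - 1) /\ quad j%:~R = m%:R].

(* The series of the (-1)^(j+k) q^(A j^2 + B j), j not in [-k, k-1]. The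
   finitely supported sum is over a finite set by finite_tail_exponents. *)
Definition tail_series (k : nat) : fps := fun m =>
  \sum_(j \in tail_exponents k m) (-1 : int) ^ (j + k%:Z).

Lemma finite_tail_exponents (k m : nat) :
  0 <= B -> B < A -> finite_set (tail_exponents k m).
Proof.
move=> B_ge0 ltBA; have AB_gt0 : 0 < A - B by rewrite subr_gt0.
pose M := (Num.truncn (m%:R / (A - B))).+1.
suff sub : tail_exponents k m `<=`
    (fun i : nat => i%:Z - M%:Z) @` `I_(M + M).+1.
  by apply: sub_finite_set sub _; exact: finite_image (finite_II _).
move=> j [_]; rewrite /quad => qj.
set x : R := j%:~R in qj.
have x2 : x ^+ 2 = `|x| ^+ 2 by rewrite real_normK ?num_real.
have Ax : A * `|x| <= A * x ^+ 2.
  rewrite ler_pM2l; last exact: le_lt_trans ltBA.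
  rewrite x2 /x -intr_norm -rmorphXn ler_int.
  have [->|j_neq0] := eqVneq j 0; first by rewrite normr0.
  by rewrite expr2 ler_peMr // -gtz0_ge1 normr_gt0.
have Bx : - (B * `|x|) <= B * x.
  by rewrite -mulrN ler_wpM2l // lerNl -normrN ler_norm.
have xM : `|x| < M%:R.
  apply: le_lt_trans (truncnS_gt _).
  by rewrite ler_pdivlMr // -qj mulrC mulrBl lerD.
have jM : `|j| < M%:Z by rewrite -(ltr_int R) intr_norm.
exists (absz (j + M%:Z)) => /=; move: jM; rewrite ltr_norml => /andP[j1 j2].
  by rewrite ltnS -lez_nat abszE ger0_norm; lia.
by rewrite abszE ger0_norm; lia.
Qed.

Definition gamma (S : {fset nat}) (k : nat) : fps :=
  fps_mul (part_series S) (tail_series k).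

End TailSeries.

Section Constants.
Variable R : realType.
Variables z1 z2 z3 z4 z5 : nat.

Let s1 : R := (z1 + z2 + z3 + z4 + z5)%:R.
Let s2 : R := (z1 ^ 2 + z2 ^ 2 + z3 ^ 2 + z4 ^ 2 + z5 ^ 2)%:R.
Let sigma : R :=
  (z1 * z2 + z1 * z3 + z1 * z4 + z1 * z5 + z2 * z3 + z2 * z4 + z2 * z5
   + z3 * z4 + z3 * z5 + z4 * z5)%:R.
Let p : R := (z1 * z2 * z3 * z4 * z5)%:R.

Definition coef_a : R := 1 / (24 * p).
Definition coef_b : R := s1 / (12 * p).
Definition coef_c : R := s2 / (24 * p) + sigma / (8 * p).
Definition coef_d : R := s1 * sigma / (24 * p).

Definition part_remainder (n : nat) : R :=
  (part_series [fset z1; z2; z3; z4; z5]%fset n)%:~R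
  - (coef_a * n%:R ^+ 4 + coef_b * n%:R ^+ 3 + coef_c * n%:R ^+ 2
     + coef_d * n%:R).

(* The least D such that |t(n)| <= D for all n; part_remainder is periodic,
   hence bounded, so that sup is the least upper bound. *)
Definition coef_e : R := sup (range (fun n => `|part_remainder n|)).

End Constants.

(* The indeterminate 'X is the variable l. *)
Section Polynomials.
Variables (R : realType) (A B k a b c d e : R).

Definition G1 : {poly R} :=
  (48 * a * (A - B) * (2 * A * k - A - B)) *: 'X^2
  + (24 * a * (2 * k + 1) * (A - B) * (2 * A * k - A - B)) *: 'X
  + ((8 * a * c - 3 * b ^+ 2) / (4 * a))%:P.

Definition G2 : {poly R} :=
  (192 * A ^+ 2 * a * k * (A - B)) *: 'X^4
  + (64 * a * (A - B) * (6 * A ^+ 2 * k ^+ 2 + 3 * A * B * k + A ^+ 2 + A * B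
   - 2 * B ^+ 2)) *: 'X^3
  + (24 * (A - B) * (8 * A ^+ 2 * a * k ^+ 3 + 12 * A * B * a * k ^+ 2
   + 6 * A ^+ 2 * a * k + 6 * A * B * a * k - 6 * B ^+ 2 * a * k
   - 2 * A * B * a + A * b * k - 2 * B ^+ 2 * a - B * b)) *: 'X^2
  + (2 * (A - B) * (48 * A * B * a * k ^+ 3 + 48 * A ^+ 2 * a * k ^+ 2
   + 48 * A * B * a * k ^+ 2 - 24 * B ^+ 2 * a * k ^+ 2 - 12 * A * B * a * k
   + 12 * A * b * k ^+ 2 - 12 * B ^+ 2 * a * k - 12 * A ^+ 2 * a
   - 12 * A * B * a - 6 * B * b * k - 3 * A * b - 3 * B * b - 2 * c)) *: 'X
  + d%:P.

Definition G3 : {poly R} :=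
  (256 * A ^+ 3 * a * k * (A - B)) *: 'X^6
  + (384 * A ^+ 2 * a * k * (A - B) * (2 * A * k + B)) *: 'X^5
  + (16 * (A - B) * (48 * A ^+ 3 * a * k ^+ 3 + 60 * A ^+ 2 * B * a * k ^+ 2
   + 6 * A ^+ 3 * a * k + 6 * A ^+ 2 * B * a * k + 12 * A * B ^+ 2 * a * k
   + 8 * A ^+ 2 * B * a + 3 * A ^+ 2 * b * k + 8 * A * B ^+ 2 * a
   - 8 * B ^+ 3 * a)) *: 'X^4
  + (16 * (A - B) * (16 * A ^+ 3 * a * k ^+ 4 + 48 * A ^+ 2 * B * a * k ^+ 3
   + 12 * A ^+ 3 * a * k ^+ 2 + 12 * A ^+ 2 * B * a * k ^+ 2
   + 24 * A * B ^+ 2 * a * k ^+ 2 + 22 * A ^+ 2 * B * a * k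
   + 6 * A ^+ 2 * b * k ^+ 2 + 22 * A * B ^+ 2 * a * k - 14 * B ^+ 3 * a * k
   + 8 * A ^+ 3 * a + 8 * A ^+ 2 * B * a - 4 * A * B ^+ 2 * a
   + 3 * A * B * b * k - 4 * B ^+ 3 * a + A ^+ 2 * b + A * B * b
   - 2 * B ^+ 2 * b)) *: 'X^3
  + (4 * (A - B) * (48 * A ^+ 2 * B * a * k ^+ 4 + 16 * A ^+ 3 * a * k ^+ 3
   + 16 * A ^+ 2 * B * a * k ^+ 3 + 64 * A * B ^+ 2 * a * k ^+ 3
   + 84 * A ^+ 2 * B * a * k ^+ 2 + 12 * A ^+ 2 * b * k ^+ 3
   + 84 * A * B ^+ 2 * a * k ^+ 2 - 36 * B ^+ 3 * a * k ^+ 2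
   + 60 * A ^+ 3 * a * k + 60 * A ^+ 2 * B * a * k - 18 * A * B ^+ 2 * a * k
   + 18 * A * B * b * k ^+ 2 - 18 * B ^+ 3 * a * k - 12 * A ^+ 2 * B * a
   + 9 * A ^+ 2 * b * k - 12 * A * B ^+ 2 * a + 9 * A * B * b * k
   - 9 * B ^+ 2 * b * k - 3 * A * B * b + 2 * A * c * k - 3 * B ^+ 2 * b
   - 2 * B * c)) *: 'X^2
  + (- 32 * A ^+ 4 * a * k ^+ 4 + 96 * A ^+ 2 * B ^+ 2 * a * k ^+ 4
   - 64 * A * B ^+ 3 * a * k ^+ 4 + 96 * A ^+ 3 * B * a * k ^+ 3
   - 128 * A * B ^+ 3 * a * k ^+ 3 + 32 * B ^+ 4 * a * k ^+ 3
   + 144 * A ^+ 4 * a * k ^+ 2 - 168 * A ^+ 2 * B ^+ 2 * a * k ^+ 2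
   + 24 * A ^+ 2 * B * b * k ^+ 3 - 24 * A * B ^+ 2 * b * k ^+ 3
   + 24 * B ^+ 4 * a * k ^+ 2 - 24 * A ^+ 3 * B * a * k
   + 24 * A ^+ 3 * b * k ^+ 2 + 24 * A * B ^+ 3 * a * k
   - 36 * A * B ^+ 2 * b * k ^+ 2 + 12 * B ^+ 3 * b * k ^+ 2 - 34 * A ^+ 4 * a
   + 36 * A ^+ 2 * B ^+ 2 * a - 6 * A ^+ 2 * B * b * k
   + 8 * A ^+ 2 * c * k ^+ 2 - 8 * A * B * c * k ^+ 2 - 2 * B ^+ 4 * a
   + 6 * B ^+ 3 * b * k - 6 * A ^+ 3 * b + 6 * A * B ^+ 2 * b
   - 4 * A * B * c * k + 4 * B ^+ 2 * c * k - 2 * A ^+ 2 * c + 2 * B ^+ 2 * c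
   - 2 * A * d + 2 * B * d - 4 * e) *: 'X
  + (- e)%:P.

Definition G4 : {poly R} :=
  (192 * A ^+ 2 * a * k * (A - B)) *: 'X^4
  + (32 * a * (A - B) * (9 * A ^+ 2 * k ^+ 2 + 12 * A ^+ 2 * k - 2 * A ^+ 2
   - 2 * A * B + B ^+ 2)) *: 'X^3
  + (48 * a * (A - B) * (2 * A ^+ 2 * k ^+ 3 + 9 * A ^+ 2 * k ^+ 2
   + 4 * A ^+ 2 * k - 2 * A * B * k + B ^+ 2 * k - 2 * A ^+ 2 - 2 * A * B
   + B ^+ 2)) *: 'X^2
  + ((A - B) * (192 * A ^+ 2 * a ^+ 2 * k ^+ 3
   + 336 * A ^+ 2 * a ^+ 2 * k ^+ 2 - 96 * A * B * a ^+ 2 * k ^+ 2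
   + 48 * B ^+ 2 * a ^+ 2 * k ^+ 2 - 192 * A * B * a ^+ 2 * k
   + 96 * B ^+ 2 * a ^+ 2 * k - 60 * A ^+ 2 * a ^+ 2 - 72 * A * B * a ^+ 2
   + 36 * B ^+ 2 * a ^+ 2 + 8 * a * c - 3 * b ^+ 2) / (2 * a)) *: 'X
  + ((2 * k + 1) * (A - B) * (16 * A ^+ 2 * a ^+ 2 * k ^+ 2
   - 32 * A * B * a ^+ 2 * k ^+ 2 + 16 * B ^+ 2 * a ^+ 2 * k ^+ 2
   + 16 * A ^+ 2 * a ^+ 2 * k - 32 * A * B * a ^+ 2 * k
   + 16 * B ^+ 2 * a ^+ 2 * k + 4 * A ^+ 2 * a ^+ 2 - 8 * A * B * a ^+ 2
   + 4 * B ^+ 2 * a ^+ 2 + 8 * a * c - 3 * b ^+ 2) / (4 * a))%:P.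

Definition G5 : {poly R} :=
  (256 * A ^+ 3 * a * k * (A - B)) *: 'X^6
  + (384 * A ^+ 2 * a * k * (A - B) * (2 * k * A + 2 * A - B)) *: 'X^5
  + (16 * (A - B) * (48 * A ^+ 3 * a * k ^+ 3 + 120 * A ^+ 3 * a * k ^+ 2
   - 60 * A ^+ 2 * B * a * k ^+ 2 + 66 * A ^+ 3 * a * k
   - 54 * A ^+ 2 * B * a * k + 12 * A * B ^+ 2 * a * k + 8 * A ^+ 2 * B * a
   + 3 * A ^+ 2 * b * k + 8 * A * B ^+ 2 * a - 8 * B ^+ 3 * a)) *: 'X^4
  + (16 * (A - B) * (16 * A ^+ 3 * a * k ^+ 4 + 96 * A ^+ 3 * a * k ^+ 3
   - 48 * A ^+ 2 * B * a * k ^+ 3 + 132 * A ^+ 3 * a * k ^+ 2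
   - 108 * A ^+ 2 * B * a * k ^+ 2 + 24 * A * B ^+ 2 * a * k ^+ 2
   + 52 * A ^+ 3 * a * k - 38 * A ^+ 2 * B * a * k + 6 * A ^+ 2 * b * k ^+ 2
   + 34 * A * B ^+ 2 * a * k - 18 * B ^+ 3 * a * k - 8 * A ^+ 3 * a
   + 8 * A ^+ 2 * B * a + 6 * A ^+ 2 * b * k + 20 * A * B ^+ 2 * a
   - 3 * A * B * b * k - 12 * B ^+ 3 * a - A ^+ 2 * b - A * B * b
   + 2 * B ^+ 2 * b)) *: 'X^3
  + (4 * (A - B) * (96 * A ^+ 3 * a * k ^+ 4 - 48 * A ^+ 2 * B * a * k ^+ 4
   + 304 * A ^+ 3 * a * k ^+ 3 - 272 * A ^+ 2 * B * a * k ^+ 3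
   + 64 * A * B ^+ 2 * a * k ^+ 3 + 312 * A ^+ 3 * a * k ^+ 2
   - 276 * A ^+ 2 * B * a * k ^+ 2 + 12 * A ^+ 2 * b * k ^+ 3
   + 156 * A * B ^+ 2 * a * k ^+ 2 - 60 * B ^+ 3 * a * k ^+ 2
   + 60 * A ^+ 3 * a * k - 60 * A ^+ 2 * B * a * k + 36 * A ^+ 2 * b * k ^+ 2
   + 162 * A * B ^+ 2 * a * k - 18 * A * B * b * k ^+ 2 - 78 * B ^+ 3 * a * k
   - 48 * A ^+ 3 * a - 12 * A ^+ 2 * B * a + 15 * A ^+ 2 * b * k
   + 60 * A * B ^+ 2 * a - 21 * A * B * b * k - 24 * B ^+ 3 * a
   + 15 * B ^+ 2 * b * k - 6 * A ^+ 2 * b - 9 * A * B * b + 2 * A * c * k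
   + 9 * B ^+ 2 * b - 2 * B * c)) *: 'X^2
  + (160 * A ^+ 4 * a * k ^+ 4 - 384 * A ^+ 3 * B * a * k ^+ 4
   + 288 * A ^+ 2 * B ^+ 2 * a * k ^+ 4 - 64 * A * B ^+ 3 * a * k ^+ 4
   + 448 * A ^+ 4 * a * k ^+ 3 - 928 * A ^+ 3 * B * a * k ^+ 3
   + 768 * A ^+ 2 * B ^+ 2 * a * k ^+ 3 - 384 * A * B ^+ 3 * a * k ^+ 3
   + 96 * B ^+ 4 * a * k ^+ 3 + 336 * A ^+ 4 * a * k ^+ 2
   - 672 * A ^+ 3 * B * a * k ^+ 2 + 48 * A ^+ 3 * b * k ^+ 3
   + 744 * A ^+ 2 * B ^+ 2 * a * k ^+ 2 - 72 * A ^+ 2 * B * b * k ^+ 3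
   - 576 * A * B ^+ 3 * a * k ^+ 2 + 24 * A * B ^+ 2 * b * k ^+ 3
   + 168 * B ^+ 4 * a * k ^+ 2 - 48 * A ^+ 4 * a * k
   - 120 * A ^+ 3 * B * a * k + 72 * A ^+ 3 * b * k ^+ 2
   + 432 * A ^+ 2 * B ^+ 2 * a * k - 144 * A ^+ 2 * B * b * k ^+ 2
   - 360 * A * B ^+ 3 * a * k + 108 * A * B ^+ 2 * b * k ^+ 2
   + 96 * B ^+ 4 * a * k - 36 * B ^+ 3 * b * k ^+ 2 - 62 * A ^+ 4 * a
   + 16 * A ^+ 3 * B * a + 12 * A ^+ 3 * b * k + 108 * A ^+ 2 * B ^+ 2 * a
   - 78 * A ^+ 2 * B * b * k + 8 * A ^+ 2 * c * k ^+ 2 - 80 * A * B ^+ 3 * a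
   + 108 * A * B ^+ 2 * b * k - 8 * A * B * c * k ^+ 2 + 18 * B ^+ 4 * a
   - 42 * B ^+ 3 * b * k - 6 * A ^+ 3 * b - 12 * A ^+ 2 * B * b
   + 8 * A ^+ 2 * c * k + 30 * A * B ^+ 2 * b - 20 * A * B * c * k
   - 12 * B ^+ 3 * b + 12 * B ^+ 2 * c * k + 2 * A ^+ 2 * c - 8 * A * B * c
   + 6 * B ^+ 2 * c + 2 * A * d - 2 * B * d - 4 * e) *: 'X
  + (a * (A - B) ^+ 4 * (2 * k + 1) ^+ 4 + b * (A - B) ^+ 3 * (2 * k + 1) ^+ 3
   + c * (A - B) ^+ 2 * (2 * k + 1) ^+ 2 + d * (A - B) * (2 * k + 1)
   - 2 * e)%:P.

Definition G6 : {poly R} :=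
  (96 * a * (A - B) * (A * k + B)) *: 'X^2
  + (12 * (A - B) * (8 * A * a * k ^+ 2 + 8 * A * a * k + 12 * B * a * k
   + 2 * A * a + 10 * B * a + b)) *: 'X
  + (48 * A ^+ 2 * a * k ^+ 2 - 48 * B ^+ 2 * a * k ^+ 2 + 48 * A ^+ 2 * a * k
   + 48 * A * B * a * k - 96 * B ^+ 2 * a * k + 12 * A ^+ 2 * a
   + 24 * A * B * a + 12 * A * b * k - 36 * B ^+ 2 * a - 12 * B * b * k
   + 6 * A * b - 6 * B * b - 2 * c)%:P.

Definition G7 : {poly R} :=
  (96 * a * (A - B) * (A * k + B)) *: 'X^2
  + (12 * (A - B) * (8 * A * a * k ^+ 2 + 16 * A * a * k + 4 * B * a * k
   - 2 * A * a + 14 * B * a - b)) *: 'X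
  + (96 * A ^+ 2 * a * k ^+ 2 - 96 * A * B * a * k ^+ 2 + 96 * A ^+ 2 * a * k
   - 48 * A * B * a * k - 48 * B ^+ 2 * a * k - 24 * A ^+ 2 * a
   + 96 * A * B * a - 72 * B ^+ 2 * a - 12 * A * b + 12 * B * b - 2 * c)%:P.

Definition G8 : {poly R} :=
  (192 * A ^+ 2 * a * k * (A - B)) *: 'X^4
  + (64 * a * (A - B) * (6 * A ^+ 2 * k ^+ 2 + 6 * A ^+ 2 * k + 3 * A * B * k
   - A ^+ 2 - B * A + 2 * B ^+ 2)) *: 'X^3
  + (24 * (A - B) * (8 * A ^+ 2 * a * k ^+ 3 + 24 * A ^+ 2 * a * k ^+ 2
   + 12 * A * B * a * k ^+ 2 + 10 * A ^+ 2 * a * k + 10 * A * B * a * k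
   + 10 * B ^+ 2 * a * k - 4 * A ^+ 2 * a - 2 * A * B * a + A * b * k
   + 10 * B ^+ 2 * a + B * b)) *: 'X^2
  + (2 * (A - B) * (96 * A ^+ 2 * a * k ^+ 3 + 48 * A * B * a * k ^+ 3
   + 144 * A ^+ 2 * a * k ^+ 2 + 144 * A * B * a * k ^+ 2
   + 72 * B ^+ 2 * a * k ^+ 2 + 24 * A ^+ 2 * a * k + 84 * A * B * a * k
   + 12 * A * b * k ^+ 2 + 156 * B ^+ 2 * a * k - 12 * A ^+ 2 * a
   + 12 * A * B * a + 12 * A * b * k + 72 * B ^+ 2 * a + 18 * B * b * k
   + 3 * A * b + 15 * B * b + 2 * c)) *: 'X
  + (32 * A ^+ 3 * a * k ^+ 3 - 32 * B ^+ 3 * a * k ^+ 3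
   + 48 * A ^+ 3 * a * k ^+ 2 + 48 * A ^+ 2 * B * a * k ^+ 2
   - 96 * B ^+ 3 * a * k ^+ 2 + 24 * A ^+ 3 * a * k + 48 * A ^+ 2 * B * a * k
   + 12 * A ^+ 2 * b * k ^+ 2 + 24 * A * B ^+ 2 * a * k - 96 * B ^+ 3 * a * k
   - 12 * B ^+ 2 * b * k ^+ 2 + 4 * A ^+ 3 * a + 12 * A ^+ 2 * B * a
   + 12 * A ^+ 2 * b * k + 12 * A * B ^+ 2 * a + 12 * A * B * b * k
   - 28 * B ^+ 3 * a - 24 * B ^+ 2 * b * k + 3 * A ^+ 2 * b + 6 * A * B * b
   + 4 * A * c * k - 9 * B ^+ 2 * b - 4 * B * c * k + 2 * A * c - 2 * B * c
   - d)%:P.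

Definition G9 : {poly R} :=
  (256 * A ^+ 3 * a * k * (A - B)) *: 'X^6
  + (384 * A ^+ 2 * a * k * (A - B) * (2 * A * k + 2 * A + B)) *: 'X^5
  + (16 * (A - B) * (48 * A ^+ 3 * a * k ^+ 3 + 120 * A ^+ 3 * a * k ^+ 2
   + 60 * A ^+ 2 * B * a * k ^+ 2 + 66 * A ^+ 3 * a * k
   + 66 * A ^+ 2 * B * a * k + 12 * A * B ^+ 2 * a * k - 8 * A ^+ 2 * B * a
   + 3 * A ^+ 2 * b * k - 8 * A * B ^+ 2 * a + 8 * B ^+ 3 * a)) *: 'X^4
  + (16 * (A - B) * (16 * A ^+ 3 * a * k ^+ 4 + 96 * A ^+ 3 * a * k ^+ 3
   + 48 * A ^+ 2 * B * a * k ^+ 3 + 132 * A ^+ 3 * a * k ^+ 2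
   + 132 * A ^+ 2 * B * a * k ^+ 2 + 24 * A * B ^+ 2 * a * k ^+ 2
   + 52 * A ^+ 3 * a * k + 62 * A ^+ 2 * B * a * k + 6 * A ^+ 2 * b * k ^+ 2
   + 14 * A * B ^+ 2 * a * k + 18 * B ^+ 3 * a * k - 8 * A ^+ 3 * a
   - 24 * A ^+ 2 * B * a + 6 * A ^+ 2 * b * k - 12 * A * B ^+ 2 * a
   + 3 * A * B * b * k + 20 * B ^+ 3 * a - A ^+ 2 * b - A * B * b
   + 2 * B ^+ 2 * b)) *: 'X^3
  + (4 * (A - B) * (96 * A ^+ 3 * a * k ^+ 4 + 48 * A ^+ 2 * B * a * k ^+ 4
   + 304 * A ^+ 3 * a * k ^+ 3 + 304 * A ^+ 2 * B * a * k ^+ 3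
   + 64 * A * B ^+ 2 * a * k ^+ 3 + 312 * A ^+ 3 * a * k ^+ 2
   + 420 * A ^+ 2 * B * a * k ^+ 2 + 12 * A ^+ 2 * b * k ^+ 3
   + 132 * A * B ^+ 2 * a * k ^+ 2 + 60 * B ^+ 3 * a * k ^+ 2
   + 60 * A ^+ 3 * a * k + 60 * A ^+ 2 * B * a * k + 36 * A ^+ 2 * b * k ^+ 2
   + 42 * A * B ^+ 2 * a * k + 18 * A * B * b * k ^+ 2 + 138 * B ^+ 3 * a * k
   - 48 * A ^+ 3 * a - 84 * A ^+ 2 * B * a + 15 * A ^+ 2 * b * k
   - 12 * A * B ^+ 2 * a + 15 * A * B * b * k + 72 * B ^+ 3 * a
   + 15 * B ^+ 2 * b * k - 6 * A ^+ 2 * b - 3 * A * B * b + 2 * A * c * k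
   + 15 * B ^+ 2 * b + 2 * B * c)) *: 'X^2
  + (160 * A ^+ 4 * a * k ^+ 4 - 96 * A ^+ 2 * B ^+ 2 * a * k ^+ 4
   - 64 * A * B ^+ 3 * a * k ^+ 4 + 448 * A ^+ 4 * a * k ^+ 3
   + 160 * A ^+ 3 * B * a * k ^+ 3 - 384 * A ^+ 2 * B ^+ 2 * a * k ^+ 3
   - 128 * A * B ^+ 3 * a * k ^+ 3 - 96 * B ^+ 4 * a * k ^+ 3
   + 336 * A ^+ 4 * a * k ^+ 2 + 192 * A ^+ 3 * B * a * k ^+ 2
   + 48 * A ^+ 3 * b * k ^+ 3 - 216 * A ^+ 2 * B ^+ 2 * a * k ^+ 2
   - 24 * A ^+ 2 * B * b * k ^+ 3 - 24 * A * B ^+ 2 * b * k ^+ 3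
   - 312 * B ^+ 4 * a * k ^+ 2 - 48 * A ^+ 4 * a * k + 24 * A ^+ 3 * B * a * k
   + 72 * A ^+ 3 * b * k ^+ 2 + 192 * A ^+ 2 * B ^+ 2 * a * k
   + 168 * A * B ^+ 3 * a * k - 36 * A * B ^+ 2 * b * k ^+ 2
   - 336 * B ^+ 4 * a * k - 36 * B ^+ 3 * b * k ^+ 2 - 62 * A ^+ 4 * a
   - 16 * A ^+ 3 * B * a + 12 * A ^+ 3 * b * k + 108 * A ^+ 2 * B ^+ 2 * a
   + 30 * A ^+ 2 * B * b * k + 8 * A ^+ 2 * c * k ^+ 2 + 80 * A * B ^+ 3 * a
   + 36 * A * B ^+ 2 * b * k - 8 * A * B * c * k ^+ 2 - 110 * B ^+ 4 * a
   - 78 * B ^+ 3 * b * k - 6 * A ^+ 3 * b + 12 * A ^+ 2 * B * b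
   + 8 * A ^+ 2 * c * k + 30 * A * B ^+ 2 * b + 4 * A * B * c * k
   - 36 * B ^+ 3 * b - 12 * B ^+ 2 * c * k + 2 * A ^+ 2 * c + 8 * A * B * c
   - 10 * B ^+ 2 * c + 2 * A * d - 2 * B * d - 4 * e) *: 'X
  + (16 * A ^+ 4 * a * k ^+ 4 - 16 * B ^+ 4 * a * k ^+ 4
   + 32 * A ^+ 4 * a * k ^+ 3 + 32 * A ^+ 3 * B * a * k ^+ 3
   - 64 * B ^+ 4 * a * k ^+ 3 + 24 * A ^+ 4 * a * k ^+ 2
   + 48 * A ^+ 3 * B * a * k ^+ 2 + 8 * A ^+ 3 * b * k ^+ 3
   + 24 * A ^+ 2 * B ^+ 2 * a * k ^+ 2 - 96 * B ^+ 4 * a * k ^+ 2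
   - 8 * B ^+ 3 * b * k ^+ 3 + 8 * A ^+ 4 * a * k + 24 * A ^+ 3 * B * a * k
   + 12 * A ^+ 3 * b * k ^+ 2 + 24 * A ^+ 2 * B ^+ 2 * a * k
   + 12 * A ^+ 2 * B * b * k ^+ 2 + 8 * A * B ^+ 3 * a * k
   - 64 * B ^+ 4 * a * k - 24 * B ^+ 3 * b * k ^+ 2 + A ^+ 4 * a
   + 4 * A ^+ 3 * B * a + 6 * A ^+ 3 * b * k + 6 * A ^+ 2 * B ^+ 2 * a
   + 12 * A ^+ 2 * B * b * k + 4 * A ^+ 2 * c * k ^+ 2 + 4 * A * B ^+ 3 * a
   + 6 * A * B ^+ 2 * b * k - 15 * B ^+ 4 * a - 24 * B ^+ 3 * b * k
   - 4 * B ^+ 2 * c * k ^+ 2 + A ^+ 3 * b + 3 * A ^+ 2 * B * b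
   + 4 * A ^+ 2 * c * k + 3 * A * B ^+ 2 * b + 4 * A * B * c * k
   - 7 * B ^+ 3 * b - 8 * B ^+ 2 * c * k + A ^+ 2 * c + 2 * A * B * c
   + 2 * A * d * k - 3 * B ^+ 2 * c - 2 * B * d * k + A * d - B * d
   - 3 * e)%:P.

Definition G10 : {poly R} :=
  (192 * A ^+ 2 * a * k * (A - B)) *: 'X^4
  + (64 * a * (A - B) * (6 * A ^+ 2 * k ^+ 2 + 12 * A ^+ 2 * k - 3 * A * B * k
   + A ^+ 2 + B * A - 2 * B ^+ 2)) *: 'X^3
  + (24 * (A - B) * (8 * A ^+ 2 * a * k ^+ 3 + 48 * A ^+ 2 * a * k ^+ 2
   - 12 * A * B * a * k ^+ 2 + 54 * A ^+ 2 * a * k - 18 * A * B * a * k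
   - 6 * B ^+ 2 * a * k + 8 * A ^+ 2 * a + 10 * A * B * a + A * b * k
   - 14 * B ^+ 2 * a + B * b)) *: 'X^2
  + (2 * (A - B) * (192 * A ^+ 2 * a * k ^+ 3 - 48 * A * B * a * k ^+ 3
   + 624 * A ^+ 2 * a * k ^+ 2 - 240 * A * B * a * k ^+ 2
   - 24 * B ^+ 2 * a * k ^+ 2 + 528 * A ^+ 2 * a * k - 132 * A * B * a * k
   + 12 * A * b * k ^+ 2 - 132 * B ^+ 2 * a * k + 84 * A ^+ 2 * a
   + 132 * A * B * a + 24 * A * b * k - 144 * B ^+ 2 * a + 6 * B * b * k
   - 3 * A * b + 21 * B * b - 2 * c)) *: 'X
  + (2 * (A - B) * (96 * A ^+ 2 * a * k ^+ 3 - 48 * A * B * a * k ^+ 3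
   + 240 * A ^+ 2 * a * k ^+ 2 - 96 * A * B * a * k ^+ 2
   - 24 * B ^+ 2 * a * k ^+ 2 + 168 * A ^+ 2 * a * k - 12 * A * B * a * k
   + 12 * A * b * k ^+ 2 - 60 * B ^+ 2 * a * k + 20 * A ^+ 2 * a
   + 44 * A * B * a + 12 * A * b * k - 40 * B ^+ 2 * a + 6 * B * b * k
   - 3 * A * b + 9 * B * b - 2 * c))%:P.

Definition G11 : {poly R} :=
  (192 * A ^+ 2 * a * k * (A - B)) *: 'X^4
  + (64 * a * (A - B) * (6 * A ^+ 2 * k ^+ 2 + 12 * A ^+ 2 * k + 3 * A * B * k
   + A ^+ 2 + B * A - 2 * B ^+ 2)) *: 'X^3
  + (24 * (A - B) * (8 * A ^+ 2 * a * k ^+ 3 + 48 * A ^+ 2 * a * k ^+ 2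
   + 12 * A * B * a * k ^+ 2 + 54 * A ^+ 2 * a * k + 30 * A * B * a * k
   - 6 * B ^+ 2 * a * k + 8 * A ^+ 2 * a + 6 * A * B * a + A * b * k
   - 18 * B ^+ 2 * a - B * b)) *: 'X^2
  + (2 * (A - B) * (192 * A ^+ 2 * a * k ^+ 3 + 48 * A * B * a * k ^+ 3
   + 624 * A ^+ 2 * a * k ^+ 2 + 336 * A * B * a * k ^+ 2
   - 24 * B ^+ 2 * a * k ^+ 2 + 528 * A ^+ 2 * a * k + 420 * A * B * a * k
   + 12 * A * b * k ^+ 2 - 156 * B ^+ 2 * a * k + 84 * A ^+ 2 * a
   + 36 * A * B * a + 24 * A * b * k - 240 * B ^+ 2 * a - 6 * B * b * k
   - 3 * A * b - 27 * B * b - 2 * c)) *: 'X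
  + (2 * (A - B) * (96 * A ^+ 2 * a * k ^+ 3 + 48 * A * B * a * k ^+ 3
   + 240 * A ^+ 2 * a * k ^+ 2 + 192 * A * B * a * k ^+ 2
   - 24 * B ^+ 2 * a * k ^+ 2 + 168 * A ^+ 2 * a * k + 156 * A * B * a * k
   + 12 * A * b * k ^+ 2 - 84 * B ^+ 2 * a * k + 20 * A ^+ 2 * a
   - 4 * A * B * a + 12 * A * b * k - 88 * B ^+ 2 * a - 6 * B * b * k
   - 3 * A * b - 15 * B * b - 2 * c))%:P.

Definition G12 : {poly R} :=
  (256 * A ^+ 3 * a * k * (A - B)) *: 'X^6
  + (384 * A ^+ 2 * a * k * (A - B) * (2 * A * k + 4 * A - B)) *: 'X^5
  + (16 * (A - B) * (48 * A ^+ 3 * a * k ^+ 3 + 240 * A ^+ 3 * a * k ^+ 2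
   - 60 * A ^+ 2 * B * a * k ^+ 2 + 246 * A ^+ 3 * a * k
   - 114 * A ^+ 2 * B * a * k + 12 * A * B ^+ 2 * a * k - 8 * A ^+ 2 * B * a
   + 3 * A ^+ 2 * b * k - 8 * A * B ^+ 2 * a + 8 * B ^+ 3 * a)) *: 'X^4
  + (16 * (A - B) * (16 * A ^+ 3 * a * k ^+ 4 + 192 * A ^+ 3 * a * k ^+ 3
   - 48 * A ^+ 2 * B * a * k ^+ 3 + 492 * A ^+ 3 * a * k ^+ 2
   - 228 * A ^+ 2 * B * a * k ^+ 2 + 24 * A * B ^+ 2 * a * k ^+ 2
   + 344 * A ^+ 3 * a * k - 238 * A ^+ 2 * B * a * k + 6 * A ^+ 2 * b * k ^+ 2
   + 26 * A * B ^+ 2 * a * k + 14 * B ^+ 3 * a * k + 8 * a * A ^+ 3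
   - 24 * A ^+ 2 * B * a + 12 * A ^+ 2 * b * k - 36 * A * B ^+ 2 * a
   - 3 * A * B * b * k + 28 * B ^+ 3 * a + A ^+ 2 * b + A * B * b
   - 2 * B ^+ 2 * b)) *: 'X^3
  + (4 * (A - B) * (192 * A ^+ 3 * a * k ^+ 4 - 48 * A ^+ 2 * B * a * k ^+ 4
   + 1168 * A ^+ 3 * a * k ^+ 3 - 560 * A ^+ 2 * B * a * k ^+ 3
   + 64 * A * B ^+ 2 * a * k ^+ 3 + 2064 * A ^+ 3 * a * k ^+ 2
   - 1380 * A ^+ 2 * B * a * k ^+ 2 + 12 * A ^+ 2 * b * k ^+ 3
   + 204 * A * B ^+ 2 * a * k ^+ 2 + 36 * B ^+ 3 * a * k ^+ 2
   + 1164 * A ^+ 3 * a * k - 1020 * A ^+ 2 * B * a * k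
   + 72 * A ^+ 2 * b * k ^+ 2 + 6 * A * B ^+ 2 * a * k
   - 18 * A * B * b * k ^+ 2 + 150 * B ^+ 3 * a * k + 96 * a * A ^+ 3
   - 84 * A ^+ 2 * B * a + 81 * A ^+ 2 * b * k - 228 * A * B ^+ 2 * a
   - 27 * A * B * b * k + 144 * B ^+ 3 * a - 9 * B ^+ 2 * b * k
   + 12 * A ^+ 2 * b + 15 * A * B * b + 2 * A * c * k - 21 * B ^+ 2 * b
   + 2 * B * c)) *: 'X^2
  + (736 * A ^+ 4 * a * k ^+ 4 - 1152 * A ^+ 3 * B * a * k ^+ 4
   + 480 * A ^+ 2 * B ^+ 2 * a * k ^+ 4 - 64 * A * B ^+ 3 * a * k ^+ 4
   + 3200 * A ^+ 4 * a * k ^+ 3 - 5472 * A ^+ 3 * B * a * k ^+ 3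
   + 2688 * A ^+ 2 * B ^+ 2 * a * k ^+ 3 - 384 * A * B ^+ 3 * a * k ^+ 3
   - 32 * B ^+ 4 * a * k ^+ 3 + 4560 * A ^+ 4 * a * k ^+ 2
   - 8352 * A ^+ 3 * B * a * k ^+ 2 + 96 * A ^+ 3 * b * k ^+ 3
   + 4248 * A ^+ 2 * B ^+ 2 * a * k ^+ 2 - 120 * A ^+ 2 * B * b * k ^+ 3
   - 192 * A * B ^+ 3 * a * k ^+ 2 + 24 * A * B ^+ 2 * b * k ^+ 3
   - 264 * B ^+ 4 * a * k ^+ 2 + 2400 * A ^+ 4 * a * k
   - 4488 * A ^+ 3 * B * a * k + 312 * A ^+ 3 * b * k ^+ 2
   + 1680 * A ^+ 2 * B ^+ 2 * a * k - 432 * A ^+ 2 * B * b * k ^+ 2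
   + 936 * A * B ^+ 3 * a * k + 108 * A * B ^+ 2 * b * k ^+ 2
   - 528 * B ^+ 4 * a * k + 12 * B ^+ 3 * b * k ^+ 2 + 350 * A ^+ 4 * a
   - 416 * A ^+ 3 * B * a + 264 * A ^+ 3 * b * k - 540 * A ^+ 2 * B ^+ 2 * a
   - 330 * A ^+ 2 * B * b * k + 8 * A ^+ 2 * c * k ^+ 2 + 928 * A * B ^+ 3 * a
   - 8 * A * B * c * k ^+ 2 - 322 * B ^+ 4 * a + 66 * B ^+ 3 * b * k
   + 42 * A ^+ 3 * b + 24 * A ^+ 2 * B * b + 16 * A ^+ 2 * c * k
   - 138 * A * B ^+ 2 * b - 12 * A * B * c * k + 72 * B ^+ 3 * b
   - 4 * B ^+ 2 * c * k - 2 * A ^+ 2 * c + 16 * A * B * c - 14 * B ^+ 2 * c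
   - 2 * A * d + 2 * B * d - 4 * e) *: 'X
  + (224 * A ^+ 4 * a * k ^+ 4 - 448 * A ^+ 3 * B * a * k ^+ 4
   + 288 * A ^+ 2 * B ^+ 2 * a * k ^+ 4 - 64 * A * B ^+ 3 * a * k ^+ 4
   + 832 * A ^+ 4 * a * k ^+ 3 - 1632 * A ^+ 3 * B * a * k ^+ 3
   + 960 * A ^+ 2 * B ^+ 2 * a * k ^+ 3 - 128 * A * B ^+ 3 * a * k ^+ 3
   - 32 * B ^+ 4 * a * k ^+ 3 + 1104 * A ^+ 4 * a * k ^+ 2
   - 2064 * A ^+ 3 * B * a * k ^+ 2 + 48 * A ^+ 3 * b * k ^+ 3
   + 984 * A ^+ 2 * B ^+ 2 * a * k ^+ 2 - 72 * A ^+ 2 * B * b * k ^+ 3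
   + 96 * A * B ^+ 3 * a * k ^+ 2 + 24 * A * B ^+ 2 * b * k ^+ 3
   - 120 * B ^+ 4 * a * k ^+ 2 + 592 * A ^+ 4 * a * k
   - 968 * A ^+ 3 * B * a * k + 120 * A ^+ 3 * b * k ^+ 2
   + 168 * A ^+ 2 * B ^+ 2 * a * k - 168 * A ^+ 2 * B * b * k ^+ 2
   + 360 * A * B ^+ 3 * a * k + 36 * A * B ^+ 2 * b * k ^+ 2
   - 152 * B ^+ 4 * a * k + 12 * B ^+ 3 * b * k ^+ 2 + 94 * A ^+ 4 * a
   - 80 * A ^+ 3 * B * a + 84 * A ^+ 3 * b * k - 156 * A ^+ 2 * B ^+ 2 * a
   - 90 * A ^+ 2 * B * b * k + 8 * A ^+ 2 * c * k ^+ 2 + 208 * A * B ^+ 3 * a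
   - 24 * A * B ^+ 2 * b * k - 8 * A * B * c * k ^+ 2 - 66 * B ^+ 4 * a
   + 30 * B ^+ 3 * b * k + 10 * A ^+ 3 * b + 12 * A ^+ 2 * B * b
   + 8 * A ^+ 2 * c * k - 42 * A * B ^+ 2 * b - 4 * A * B * c * k
   + 20 * B ^+ 3 * b - 4 * B ^+ 2 * c * k - 2 * A ^+ 2 * c + 8 * A * B * c
   - 6 * B ^+ 2 * c - 2 * A * d + 2 * B * d - 4 * e)%:P.

Definition Gs : seq {poly R} :=
  [:: G1; G2; G3; G4; G5; G6; G7; G8; G9; G10; G11; G12].

End Polynomials.

(* The maximum of 1 and of the real roots of the polynomials in ps. For the
   zero polynomial rootsR is empty, but no G_i is zero when A > B >= 0, k >= 1
   and a > 0. *)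
Definition max_root (R : realType) (ps : seq {poly R}) : R :=
  \big[Num.max/1]_(x <- flatten [seq rootsR p | p <- ps]) x.

Section Threshold.
Variables (R : realType) (A B : R) (k z1 z2 z3 z4 z5 : nat).

Definition threshold_L : int :=
  Num.ceil (max_root (Gs A B k%:R
    (coef_a R z1 z2 z3 z4 z5) (coef_b R z1 z2 z3 z4 z5)
    (coef_c R z1 z2 z3 z4 z5) (coef_d R z1 z2 z3 z4 z5)
    (coef_e R z1 z2 z3 z4 z5))).

Definition threshold_N : R := quad A B (k%:R + 2 * threshold_L%:~R).

End Threshold.

(* Main.v *)
(** Let f(n) = a n^4 + b n^3 + c n^2 + d n and let e bound |t(n)|, so that the
    coefficient of q^n in the partition series is f(n) up to e. If n lies
    between two consecutive exponents A j^2 + B j, exactly T = 4l + m of them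
    (1 <= m <= 4) are at most n, and gamma(n) is at least W(n) - T e, where W is
    the alternating sum of the T polynomials f(n - A j^2 - B j). For m = 1, ...,
    4 the values of G3, G5, G9, G12 at l are those of W - T e at the left end of
    the interval; the other G_i control the derivatives of W there: they are
    first or second derivatives at end points, or minima of derivatives that are
    convex quadratics. Since the G_i have positive leading coefficients, all of
    these are nonnegative as soon as l is at least the largest root. The bound
    on t comes from the partial fraction decomposition of the partition series,
    whose only multiple pole is 1. *)
Require Import Defs.
From mathcomp Require Import all_boot all_order all_algebra finmap.
From mathcomp Require Import ring lra zify polyrcf.
From mathcomp Require Import all_classical all_reals.

Set Implicit Arguments.
Unset Strict Implicit.
Unset Printing Implicit Defensive.

Import Order.TTheory GRing.Theory Num.Theory.
Local Open Scope ring_scope.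

(** * Alternating sums of a quartic *)

Section AlternatingSums.
Variable R : realType.
Variables A B : R.
Local Notation Q := (quad A B).

(* The summands j = x, -x-1, x+1, -x-2, with the sign (-1)^(j+k) when x = k
   modulo 2. *)
Definition block (g : R -> R) (x u : R) : R :=
  g (u - Q x) - g (u - Q (- x - 1)) - g (u - Q (x + 1)) + g (u - Q (- x - 2)).

(** The case [m = 4] is a whole block, so that the remainder is never empty and [l] is the index of
    the block holding the last term. *)
Definition rest (m : nat) (g : R -> R) (x u : R) : R :=
  match m with
  | 1%N => g (u - Q x)
  | 2%N => g (u - Q x) - g (u - Q (- x - 1))
  | 3%N => g (u - Q x) - g (u - Q (- x - 1)) - g (u - Q (x + 1))
  | _ => block g x u
  end.

Definition altsum (m : nat) (g : R -> R) (k : R) (l : nat) (u : R) : R :=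
  \sum_(i < l) block g (k + 2 * i%:R) u + rest m g (k + 2 * l%:R) u.

(** The induction removes the first block, not the last: replacing [k] by [k + 2] and [l + 1] by [l]
    preserves [k + 2 (l + 1)], hence the evaluation point. A closed form then only needs two
    polynomial identities. *)
Lemma altsum_ind m g (E : R -> R) (P : R -> R -> R) :
  (forall y, rest m g y (E y) = P y 0) ->
  (forall k l, block g k (E (k + 2 * (l + 1))) + P (k + 2) l = P k (l + 1)) ->
  forall k l, altsum m g k l (E (k + 2 * l%:R)) = P k l%:R.
Proof.
move=> P0 PS k l; elim: l k => [|l IHl] k.
  by rewrite /altsum big_ord0 add0r mulr0 addr0 P0.
have shift : k + 2 * l.+1%:R = k + 2 + 2 * l%:R by rewrite -natr1; ring.
rewrite -[in RHS]natr1 -PS natr1 -IHl -shift /altsum.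
rewrite big_ord_recl /= mulr0 addr0 -addrA; congr (_ + (_ + _)).
  apply: eq_bigr => i _; rewrite /bump /= natrD; congr block; ring.
by congr rest; ring.
Qed.

(** The sum of all the signs; full blocks contribute 0. *)
Definition sgn_altsum (m : nat) : R :=
  match m with 1%N => 1 | 3%N => -1 | _ => 0 end.

(** By linearity a Taylor expansion of [g] passes to the sum; [s4] does not depend on the point, so
    only the signs remain in front of it. *)
Lemma altsum_shift m (g g1 g2 g3 : R -> R) (t s1 s2 s3 s4 : R) :
  (forall x, g (x + t) = g x + g1 x * s1 + g2 x * s2 + g3 x * s3 + s4) ->
  forall k l u, altsum m g k l (u + t) =
    altsum m g k l u + altsum m g1 k l u * s1 + altsum m g2 k l u * s2
    + altsum m g3 k l u * s3 + sgn_altsum m * s4.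
Proof.
move=> gD k l u.
have gB v : g (u + t - v) = g (u - v) + g1 (u - v) * s1 + g2 (u - v) * s2
    + g3 (u - v) * s3 + s4 by rewrite addrAC gD.
have blockT x : block g x (u + t) =
    block g x u + block g1 x u * s1 + block g2 x u * s2 + block g3 x u * s3.
  by rewrite /block !gB; ring.
have restT x : rest m g x (u + t) = rest m g x u + rest m g1 x u * s1
    + rest m g2 x u * s2 + rest m g3 x u * s3 + sgn_altsum m * s4.
  by case: m => [|[|[|[|m]]]]; rewrite /rest /sgn_altsum ?blockT ?gB; ring.
have sumT : \sum_(i < l) block g (k + 2 * i%:R) (u + t)
    = \sum_(i < l) block g (k + 2 * i%:R) u
    + \sum_(i < l) block g1 (k + 2 * i%:R) u * s1
    + \sum_(i < l) block g2 (k + 2 * i%:R) u * s2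
    + \sum_(i < l) block g3 (k + 2 * i%:R) u * s3.
  by rewrite -!big_split; apply: eq_bigr => i _; rewrite blockT.
by rewrite /altsum restT sumT -!mulr_suml; ring.
Qed.

Section Quartic.
Variables a b c d : R.

Definition quartic (x : R) : R := a * x ^+ 4 + b * x ^+ 3 + c * x ^+ 2 + d * x.
(** With [f] the quartic, [quartic1], [quartic2] and [quartic3] are the Taylor coefficients f',
    f''/2 and f'''/6. *)
Definition quartic1 (x : R) : R :=
  4 * a * x ^+ 3 + 3 * b * x ^+ 2 + 2 * c * x + d.
Definition quartic2 (x : R) : R := 6 * a * x ^+ 2 + 3 * b * x + c.
Definition quartic3 (x : R) : R := 4 * a * x + b.

Lemma altsum_quarticD m k l u t :
  altsum m quartic k l (u + t)
  = altsum m quartic k l u + altsum m quartic1 k l u * t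
    + altsum m quartic2 k l u * t ^+ 2 + altsum m quartic3 k l u * t ^+ 3
    + sgn_altsum m * (a * t ^+ 4).
Proof.
by apply: altsum_shift => x;
  rewrite /quartic /quartic1 /quartic2 /quartic3; ring.
Qed.

Lemma altsum_quartic1D m k l u t :
  altsum m quartic1 k l (u + t) = altsum m quartic1 k l u
    + altsum m quartic2 k l u * (2 * t) + altsum m quartic3 k l u * (3 * t ^+ 2)
    + altsum m quartic3 k l u * 0 + sgn_altsum m * (4 * a * t ^+ 3).
Proof.
by apply: altsum_shift => x; rewrite /quartic1 /quartic2 /quartic3; ring.
Qed.

Lemma altsum_quartic2D m k l u t :
  altsum m quartic2 k l (u + t) = altsum m quartic2 k l u
    + altsum m quartic3 k l u * (3 * t) + altsum m quartic3 k l u * 0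
    + altsum m quartic3 k l u * 0 + sgn_altsum m * (6 * a * t ^+ 2).
Proof.
by apply: altsum_shift => x; rewrite /quartic2 /quartic3; ring.
Qed.

(* For m = 2 the derivative of the sum is slope2 * (3 t^2 + 2 offset2 t) plus a
   constant, where t is the distance to the left end point. *)
Definition slope2 (k l : R) : R := 4 * a * (A - B) * (2 * k + 2 * l + 1).
Definition offset2 (k l : R) : R :=
  3 / 2 * (A - B) * (2 * k + 1) + 6 * (A * k - B) * l + 3 * b / (4 * a).

Ltac altsum_tac E P :=
  apply: (@altsum_ind _ _ E P) => *;
  rewrite /rest /block /quad /quartic /quartic1 /quartic2 /quartic3
    ?/slope2 ?/offset2 ?(hornerD, hornerZ, hornerXn, hornerX, hornerC).

Lemma altsum1_quartic3 k l :
  altsum 1 quartic3 k l (Q (k + 2 * l%:R)) = b - 8 * a * (A - B) * l%:R.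
Proof.
by altsum_tac (quad A B) (fun k l : R => b - 8 * a * (A - B) * l); ring.
Qed.

(** With [w2], [w3] the sums of [quartic2], [quartic3], half the second derivative at distance t is
    [w2 + 3 w3 t + 6 a t^2]. Its minimum [w2 - 3 w3^2 / (8 a)] is half of [G1]. *)
Lemma altsum1_quartic2 k l : a != 0 ->
  altsum 1 quartic2 k l (Q (k + 2 * l%:R))
  = ((G1 A B k a b c).[l%:R]
    + 3 * (b - 8 * a * (A - B) * l%:R) ^+ 2 / (4 * a)) / 2.
Proof.
by move=> a_neq0; altsum_tac (quad A B)
  (fun k l : R => ((G1 A B k a b c).[l]
    + 3 * (b - 8 * a * (A - B) * l) ^+ 2 / (4 * a)) / 2); field.
Qed.

Lemma altsum1_quartic1 k l :
  altsum 1 quartic1 k l (Q (k + 2 * l%:R)) = (G2 A B k a b c d).[l%:R].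
Proof.
by altsum_tac (quad A B) (fun k l : R => (G2 A B k a b c d).[l]); ring.
Qed.

Lemma altsum1_quartic e k l :
  altsum 1 quartic k l (Q (k + 2 * l%:R))
  = (G3 A B k a b c d e).[l%:R] + (4 * l%:R + 1) * e.
Proof.
by altsum_tac (quad A B)
  (fun k l : R => (G3 A B k a b c d e).[l] + (4 * l + 1) * e); ring.
Qed.

Lemma altsum2_quartic3 k l :
  altsum 2 quartic3 k l (Q (- (k + 2 * l%:R) - 1)) = slope2 k l%:R.
Proof.
by altsum_tac (fun y => Q (- y - 1)) (fun k l : R => slope2 k l); ring.
Qed.

Lemma altsum2_quartic2 k l : a != 0 ->
  altsum 2 quartic2 k l (Q (- (k + 2 * l%:R) - 1))
  = slope2 k l%:R * offset2 k l%:R.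
Proof.
by move=> a_neq0; altsum_tac (fun y => Q (- y - 1))
  (fun k l : R => slope2 k l * offset2 k l); field.
Qed.

Lemma altsum2_quartic1 k l : a != 0 ->
  altsum 2 quartic1 k l (Q (- (k + 2 * l%:R) - 1))
  = (G4 A B k a b c).[l%:R] + slope2 k l%:R * offset2 k l%:R ^+ 2 / 3.
Proof.
by move=> a_neq0; altsum_tac (fun y => Q (- y - 1))
  (fun k l : R => (G4 A B k a b c).[l]
    + slope2 k l * offset2 k l ^+ 2 / 3); field.
Qed.

Lemma altsum2_quartic e k l :
  altsum 2 quartic k l (Q (- (k + 2 * l%:R) - 1))
  = (G5 A B k a b c d e).[l%:R] + (4 * l%:R + 2) * e.
Proof.
by altsum_tac (fun y => Q (- y - 1))
  (fun k l : R => (G5 A B k a b c d e).[l] + (4 * l + 2) * e); ring.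
Qed.

Lemma altsum3_quartic2_left k l :
  altsum 3 quartic2 k l (Q (k + 2 * l%:R + 1)) = (G6 A B k a b c).[l%:R] / 2.
Proof.
by altsum_tac (fun y => Q (y + 1))
  (fun k l : R => (G6 A B k a b c).[l] / 2); field.
Qed.

Lemma altsum3_quartic2_right k l :
  altsum 3 quartic2 k l (Q (- (k + 2 * l%:R) - 2))
  = (G7 A B k a b c).[l%:R] / 2.
Proof.
by altsum_tac (fun y => Q (- y - 2))
  (fun k l : R => (G7 A B k a b c).[l] / 2); field.
Qed.

Lemma altsum3_quartic1 k l :
  altsum 3 quartic1 k l (Q (k + 2 * l%:R + 1)) = (G8 A B k a b c d).[l%:R].
Proof.
by altsum_tac (fun y => Q (y + 1))
  (fun k l : R => (G8 A B k a b c d).[l]); ring.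
Qed.

Lemma altsum3_quartic e k l :
  altsum 3 quartic k l (Q (k + 2 * l%:R + 1))
  = (G9 A B k a b c d e).[l%:R] + (4 * l%:R + 3) * e.
Proof.
by altsum_tac (fun y => Q (y + 1))
  (fun k l : R => (G9 A B k a b c d e).[l] + (4 * l + 3) * e); ring.
Qed.

Lemma altsum4_quartic3 k l :
  altsum 4 quartic3 k l (Q (- (k + 2 * l%:R) - 2))
  = - 8 * a * (A - B) * (l%:R + 1).
Proof.
by altsum_tac (fun y => Q (- y - 2))
  (fun k l : R => - 8 * a * (A - B) * (l + 1)); ring.
Qed.

Lemma altsum4_quartic1_left k l :
  altsum 4 quartic1 k l (Q (- (k + 2 * l%:R) - 2)) = (G10 A B k a b c).[l%:R].
Proof.
by altsum_tac (fun y => Q (- y - 2))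
  (fun k l : R => (G10 A B k a b c).[l]); ring.
Qed.

Lemma altsum4_quartic1_right k l :
  altsum 4 quartic1 k l (Q (k + 2 * l%:R + 2)) = (G11 A B k a b c).[l%:R].
Proof.
by altsum_tac (fun y => Q (y + 2)) (fun k l : R => (G11 A B k a b c).[l]); ring.
Qed.

Lemma altsum4_quartic e k l :
  altsum 4 quartic k l (Q (- (k + 2 * l%:R) - 2))
  = (G12 A B k a b c d e).[l%:R] + (4 * l%:R + 4) * e.
Proof.
by altsum_tac (fun y => Q (- y - 2))
  (fun k l : R => (G12 A B k a b c d e).[l] + (4 * l + 4) * e); ring.
Qed.

End Quartic.
End AlternatingSums.

(** * Lower bounds for each number of terms modulo 4 *)

Section LowerBounds.
Variables (R : realType) (A B a b c d e k : R) (l : nat).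
Hypotheses (a_gt0 : 0 < a) (ltBA : B < A) (k_ge0 : 0 <= k).
Local Notation Q := (quad A B).
Local Notation f := (quartic a b c d).

(* The second derivative of the sum is a convex quadratic with minimum G1. *)
Lemma altsum1_ge u :
  0 <= (G1 A B k a b c).[l%:R] -> 0 <= (G2 A B k a b c d).[l%:R] ->
  0 <= (G3 A B k a b c d e).[l%:R] -> Q (k + 2 * l%:R) <= u ->
  (4 * l%:R + 1) * e <= altsum A B 1 f k l u.
Proof.
move=> G1_ge0 G2_ge0 G3_ge0 le_u.
have a_neq0 : a != 0 by rewrite gt_eqF.
pose t := u - Q (k + 2 * l%:R).
have t_ge0 : 0 <= t by rewrite subr_ge0.
have -> : u = Q (k + 2 * l%:R) + t by rewrite /t; ring.
rewrite altsum_quarticD (altsum1_quartic _ _ _ _ _ _ e) altsum1_quartic1.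
rewrite altsum1_quartic2 // altsum1_quartic3.
move: G1_ge0 G2_ge0 G3_ge0; set g1 := _.[_]; set g2 := _.[_]; set g3 := _.[_].
set w := b - _ => g1_ge0 g2_ge0 g3_ge0.
rewrite /sgn_altsum -subr_ge0.
(* The square in the factor of [t^2] is completed by splitting [3 w^2 / (8 a)] into
   [w^2 / (4 a) + w^2 / (8 a)]. *)
have -> : g3 + (4 * l%:R + 1) * e + g2 * t
  + (g1 + 3 * w ^+ 2 / (4 * a)) / 2 * t ^+ 2 + w * t ^+ 3 + 1 * (a * t ^+ 4)
  - (4 * l%:R + 1) * e = g3 + g2 * t + t ^+ 2 *
    (g1 / 2 + a * (t + w / (2 * a)) ^+ 2 + w ^+ 2 / (8 * a)) by field.
have := mulr_ge0 g2_ge0 t_ge0; have := sqr_ge0 t.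
have : 0 <= w ^+ 2 / (8 * a) by rewrite divr_ge0 ?sqr_ge0 // mulr_ge0 // ltW.
have : 0 <= a * (t + w / (2 * a)) ^+ 2 by rewrite mulr_ge0 ?sqr_ge0 // ltW.
move: (_ / (8 * a)) (a * _) => p q p_ge0 q_ge0 t2_ge0 ?.
rewrite addr_ge0 ?addr_ge0 // mulr_ge0 //; lra.
Qed.

(* The derivative of the sum is a convex quadratic with minimum G4. *)
Lemma altsum2_ge u :
  0 <= (G4 A B k a b c).[l%:R] -> 0 <= (G5 A B k a b c d e).[l%:R] ->
  Q (- (k + 2 * l%:R) - 1) <= u ->
  (4 * l%:R + 2) * e <= altsum A B 2 f k l u.
Proof.
move=> G4_ge0 G5_ge0 le_u.
have a_neq0 : a != 0 by rewrite gt_eqF.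
pose t := u - Q (- (k + 2 * l%:R) - 1).
have t_ge0 : 0 <= t by rewrite subr_ge0.
have -> : u = Q (- (k + 2 * l%:R) - 1) + t by rewrite /t; ring.
rewrite altsum_quarticD (altsum2_quartic _ _ _ _ _ _ e) altsum2_quartic1 //.
rewrite altsum2_quartic2 // altsum2_quartic3.
move: G4_ge0 G5_ge0; set g1 := _.[_]; set g2 := _.[_].
set w := slope2 _ _ _ _ _; set s := offset2 _ _ _ _ _ _ => g1_ge0 g2_ge0.
have w_ge0 : 0 <= w.
  have : 0 <= 2 * k + 2 * l%:R + 1 by rewrite !addr_ge0 ?mulr_ge0.
  by rewrite /w /slope2 => ?; rewrite !mulr_ge0 // ?subr_ge0 ltW.
rewrite /sgn_altsum -subr_ge0.
have -> : g2 + (4 * l%:R + 2) * e + (g1 + w * s ^+ 2 / 3) * t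
  + w * s * t ^+ 2 + w * t ^+ 3 + 0 * (a * t ^+ 4) - (4 * l%:R + 2) * e
  = g2 + t * (g1 + w * ((t + s / 2) ^+ 2 + s ^+ 2 / 12)) by field.
by rewrite addr_ge0 // mulr_ge0 // addr_ge0 // mulr_ge0 // addr_ge0
  ?divr_ge0 ?sqr_ge0.
Qed.

(* On the interval between the two exponents the second derivative of the sum
   is a concave quadratic, and G6 and G7 are its values at the end points. *)
Lemma altsum3_ge u :
  0 <= (G6 A B k a b c).[l%:R] -> 0 <= (G7 A B k a b c).[l%:R] ->
  0 <= (G8 A B k a b c d).[l%:R] -> 0 <= (G9 A B k a b c d e).[l%:R] ->
  Q (k + 2 * l%:R + 1) <= u < Q (- (k + 2 * l%:R) - 2) ->
  (4 * l%:R + 3) * e <= altsum A B 3 f k l u.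
Proof.
move=> G6_ge0 G7_ge0 G8_ge0 G9_ge0 /andP[le_u lt_u].
pose t := u - Q (k + 2 * l%:R + 1).
pose T := Q (- (k + 2 * l%:R) - 2) - Q (k + 2 * l%:R + 1).
have t_ge0 : 0 <= t by rewrite subr_ge0.
have ltT : t < T by rewrite ltrD2r.
have T_gt0 : 0 < T by exact: le_lt_trans ltT.
have -> : u = Q (k + 2 * l%:R + 1) + t by rewrite /t; ring.
have := altsum3_quartic2_right A B a b c k l.
have -> : Q (- (k + 2 * l%:R) - 2) = Q (k + 2 * l%:R + 1) + T by rewrite /T; ring.
rewrite altsum_quartic2D altsum_quarticD (altsum3_quartic _ _ _ _ _ _ e).
rewrite altsum3_quartic1 altsum3_quartic2_left /sgn_altsum.
move: G6_ge0 G7_ge0 G8_ge0 G9_ge0.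
set g6 := _.[_]; set g7 := _.[_]; set g8 := _.[_]; set g9 := _.[_].
move=> g6_ge0 g7_ge0 g8_ge0 g9_ge0; move: (altsum _ _ _ _ _ _ _) => w Ew.
(* The cubic coefficient is recovered from the second derivatives at both ends:
   [g6 / 2 + 3 w T - 6 a T^2 = g7 / 2]. *)
have {Ew}-> : w = (g7 - g6 + 12 * a * T ^+ 2) / (6 * T).
  apply/eqP; rewrite eq_sym -subr_eq0; move/eqP: Ew; rewrite -subr_eq0.
  rewrite (_ : _ - _ = - (3 * T) *
    ((g7 - g6 + 12 * a * T ^+ 2) / (6 * T) - w)); last by field; rewrite gt_eqF.
  by rewrite mulf_eq0 oppr_eq0 mulf_eq0 (gt_eqF T_gt0) pnatr_eq0.
rewrite -subr_ge0.
(* The sum is now a combination of [g6], ..., [g9] and [a] whose weights are nonnegative for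
   [0 <= t < T]. *)
have -> : g9 + (4 * l%:R + 3) * e + g8 * t + g6 / 2 * t ^+ 2
    + (g7 - g6 + 12 * a * T ^+ 2) / (6 * T) * t ^+ 3 + -1 * (a * t ^+ 4)
    - (4 * l%:R + 3) * e
  = g9 + g8 * t + t ^+ 2 / T * (g6 / 6 * (3 * T - t) + g7 / 6 * t
      + a * t * T * (2 * T - t)) by field; rewrite gt_eqF.
have ltT3 : 0 <= 3 * T - t by lra.
have ltT2 : 0 <= 2 * T - t by lra.
have a_ge0 := ltW a_gt0; have T_ge0 := ltW T_gt0.
apply: addr_ge0; first by rewrite addr_ge0 // mulr_ge0.
by rewrite mulr_ge0 ?divr_ge0 ?sqr_ge0 // !addr_ge0 // !mulr_ge0 // ?invr_ge0.
Qed.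

(* The derivative of the sum is a concave quadratic with values G10 and G11 at
   the end points. *)
Lemma altsum4_ge u :
  0 <= (G10 A B k a b c).[l%:R] -> 0 <= (G11 A B k a b c).[l%:R] ->
  0 <= (G12 A B k a b c d e).[l%:R] ->
  Q (- (k + 2 * l%:R) - 2) <= u < Q (k + 2 * l%:R + 2) ->
  (4 * l%:R + 4) * e <= altsum A B 4 f k l u.
Proof.
move=> G10_ge0 G11_ge0 G12_ge0 /andP[le_u lt_u].
pose t := u - Q (- (k + 2 * l%:R) - 2).
pose T := Q (k + 2 * l%:R + 2) - Q (- (k + 2 * l%:R) - 2).
have t_ge0 : 0 <= t by rewrite subr_ge0.
have ltT : t < T by rewrite ltrD2r.
have T_gt0 : 0 < T by exact: le_lt_trans ltT.
have -> : u = Q (- (k + 2 * l%:R) - 2) + t by rewrite /t; ring.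
have := altsum4_quartic1_right A B a b c d k l.
have -> : Q (k + 2 * l%:R + 2) = Q (- (k + 2 * l%:R) - 2) + T by rewrite /T; ring.
rewrite altsum_quartic1D altsum_quarticD (altsum4_quartic _ _ _ _ _ _ e).
rewrite altsum4_quartic1_left altsum4_quartic3 /sgn_altsum.
move: G10_ge0 G11_ge0 G12_ge0; set g1 := _.[_]; set g2 := _.[_]; set g3 := _.[_].
move=> g1_ge0 g2_ge0 g3_ge0; move: (altsum _ _ _ _ _ _ _) => w Ew.
pose v := 8 * a * (A - B) * (l%:R + 1).
have v_ge0 : 0 <= v.
  by rewrite mulr_ge0 ?addr_ge0 // mulr_ge0 ?subr_ge0 ?mulr_ge0 // ltW.
have vE : - 8 * a * (A - B) * (l%:R + 1) = - v by rewrite /v; ring.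
(* Here the quadratic coefficient comes from the first derivatives at both ends:
   [g1 + 2 w T - 3 v T^2 = g2]. *)
have {Ew}-> : w = (g2 - g1 + 3 * v * T ^+ 2) / (2 * T).
  apply/eqP; rewrite eq_sym -subr_eq0; move/eqP: Ew; rewrite vE -subr_eq0.
  rewrite (_ : _ - _ = - (2 * T) *
    ((g2 - g1 + 3 * v * T ^+ 2) / (2 * T) - w)); last by field; rewrite gt_eqF.
  by rewrite mulf_eq0 oppr_eq0 mulf_eq0 (gt_eqF T_gt0) pnatr_eq0.
rewrite vE -subr_ge0.
have -> : g3 + (4 * l%:R + 4) * e + g1 * t
    + (g2 - g1 + 3 * v * T ^+ 2) / (2 * T) * t ^+ 2 + - v * t ^+ 3
    + 0 * (a * t ^+ 4) - (4 * l%:R + 4) * e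
  = g3 + t / T * (g1 / 2 * (2 * T - t) + g2 / 2 * t
      + v * t * T * (3 * T - 2 * t) / 2) by field; rewrite gt_eqF.
have ltT3 : 0 <= 3 * T - 2 * t by lra.
have ltT2 : 0 <= 2 * T - t by lra.
have T_ge0 := ltW T_gt0.
rewrite addr_ge0 // mulr_ge0 ?divr_ge0 // !addr_ge0 //.
- by rewrite mulr_ge0 ?divr_ge0.
- by rewrite mulr_ge0 ?divr_ge0.
- apply: divr_ge0 => //; apply: mulr_ge0 => //; apply: mulr_ge0 => //.
  exact: mulr_ge0.
Qed.

End LowerBounds.

(** * Nonnegativity beyond the largest root *)

Section RootBound.
Variable R : realType.

(** Unless [x] is itself a root, [p] has no root in [[x, +oo)], so its sign at [x] is that of its
    leading coefficient. *)
Lemma horner_ge0_max_root (p : {poly R}) (ps : seq {poly R}) (n : nat) (x : R) :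
  p \in ps -> (size p <= n.+1)%N -> 0 < p`_n -> max_root ps <= x -> 0 <= p.[x].
Proof.
move=> p_ps size_p pn_gt0 le_x.
have size_pE : size p = n.+1.
  by apply/eqP; rewrite eqn_leq size_p ltnNge; apply/negP => /leq_sizeP/(_ n);
    rewrite leqnn => /(_ isT) pn0; rewrite pn0 ltxx in pn_gt0.
have lead_gt0 : 0 < lead_coef p by rewrite lead_coefE size_pE.
have p_neq0 : p != 0 by rewrite -lead_coef_eq0 gt_eqF.
have [/rootP -> //|root_x] := boolP (root p x).
suff: Num.sg p.[x] = 1 by move/eqP; rewrite sgr_cp0 => /ltW.
rewrite (@sgp_pinftyP _ x) ?in_itv /= ?lexx /sgp_pinfty ?gtr0_sg // => y.
rewrite in_itv /= andbT le_eqVlt => /predU1P[<- //|lt_xy].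
apply/negP => root_y; move: lt_xy; apply/negP; rewrite -leNgt.
apply: le_trans le_x; rewrite /max_root.
apply: (@le_bigmax_seq _ _ _ _ _ y xpredT id) => //.
apply/flatten_mapP; exists p => //.
by rewrite -roots_on_rootsR ?in_itv.
Qed.

Lemma max_root_ge1 (ps : seq {poly R}) : 1 <= max_root ps.
Proof. exact: bigmax_ge_id. Qed.

Definition lead_gt0 (p : {poly R}) : Prop :=
  exists n, (size p <= n.+1)%N /\ 0 < p`_n.

Lemma lead_gt0_deg2 (c2 c1 c0 : R) : 0 < c2 ->
  lead_gt0 (c2 *: 'X^2 + c1 *: 'X + c0%:P).
Proof.
move=> c_gt0; exists 2%N; split; last first.
  by rewrite !(coefD, coefZ, coefXn, coefX, coefC) /= !mulr0 !addr0 mulr1.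
apply/leq_sizeP; case=> [|[|[|j]]] //= _.
by rewrite !(coefD, coefZ, coefXn, coefX, coefC) /= !mulr0 !addr0.
Qed.

Lemma lead_gt0_deg4 (c4 c3 c2 c1 c0 : R) : 0 < c4 ->
  lead_gt0 (c4 *: 'X^4 + c3 *: 'X^3 + c2 *: 'X^2 + c1 *: 'X + c0%:P).
Proof.
move=> c_gt0; exists 4%N; split; last first.
  by rewrite !(coefD, coefZ, coefXn, coefX, coefC) /= !mulr0 !addr0 mulr1.
apply/leq_sizeP; case=> [|[|[|[|[|j]]]]] //= _.
by rewrite !(coefD, coefZ, coefXn, coefX, coefC) /= !mulr0 !addr0.
Qed.

Lemma lead_gt0_deg6 (c6 c5 c4 c3 c2 c1 c0 : R) : 0 < c6 ->
  lead_gt0 (c6 *: 'X^6 + c5 *: 'X^5 + c4 *: 'X^4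
    + c3 *: 'X^3 + c2 *: 'X^2 + c1 *: 'X + c0%:P).
Proof.
move=> c_gt0; exists 6%N; split; last first.
  by rewrite !(coefD, coefZ, coefXn, coefX, coefC) /= !mulr0 !addr0 mulr1.
apply/leq_sizeP; case=> [|[|[|[|[|[|[|j]]]]]]] //= _.
by rewrite !(coefD, coefZ, coefXn, coefX, coefC) /= !mulr0 !addr0.
Qed.

Variables (A B k a b c d e l : R).
Hypotheses (a_gt0 : 0 < a) (B_ge0 : 0 <= B) (ltBA : B < A) (k_ge1 : 1 <= k).

(** Only [G1], [G6] and [G7] have a leading factor that is not visibly positive: [2 A k - A - B],
    respectively [A k + B]. *)
Lemma Gs_lead_gt0 p : p \in Gs A B k a b c d e ->
  lead_gt0 p.
Proof.
move=> p_in.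
have AB_gt0 : 0 < A - B by rewrite subr_gt0.
have A_gt0 : 0 < A by exact: le_lt_trans ltBA.
have k_gt0 : 0 < k by exact: lt_le_trans k_ge1.
have AkB_gt0 : 0 < A * k + B by rewrite ltr_pwDl // mulr_gt0.
have AkAB_gt0 : 0 < 2 * A * k - A - B.
  have : A <= A * k by rewrite ler_peMr // ltW.
  by lra.
move: p_in; rewrite /Gs.
have in_cons (q : {poly R}) s : p \in q :: s -> p = q \/ p \in s.
  by rewrite inE => /predU1P.
move=> /in_cons[->|/in_cons[->|/in_cons[->|/in_cons[->|/in_cons[->|/in_cons[->|
  /in_cons[->|/in_cons[->|/in_cons[->|/in_cons[->|/in_cons[->|/in_cons[->|//]
  ]]]]]]]]]]];
  first [ apply: lead_gt0_deg2 | apply: lead_gt0_deg4 | apply: lead_gt0_deg6 ];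
  by rewrite !mulr_gt0 // exprn_gt0.
Qed.

Lemma Gs_ge0 : max_root (Gs A B k a b c d e) <= l ->
  forall p, p \in Gs A B k a b c d e -> 0 <= p.[l].
Proof.
move=> le_l p p_in; have [n [size_p pn_gt0]] := Gs_lead_gt0 p_in.
exact: (horner_ge0_max_root p_in size_p pn_gt0).
Qed.

End RootBound.

(** * The partition function is a quartic up to a bounded error *)

Section PowerSeries.
Variable R : fieldType.

(** Congruence modulo [X^N]: power series are handled through polynomial truncations, where
    divisibility and [ring] are available. *)
Definition eqX (N : nat) (p q : {poly R}) : Prop :=
  forall i, (i < N)%N -> p`_i = q`_i.

Lemma eqX_sym N p q : eqX N p q -> eqX N q p.
Proof. by move=> pq i /pq. Qed.

Lemma eqX_trans N q p r : eqX N p q -> eqX N q r -> eqX N p r.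
Proof. by move=> pq qr i iN; rewrite pq ?qr. Qed.

Lemma eqXD N p q p' q' : eqX N p q -> eqX N p' q' -> eqX N (p + p') (q + q').
Proof. by move=> pq pq' i iN; rewrite !coefD pq ?pq'. Qed.

Lemma eqXM N r p q : eqX N p q -> eqX N (r * p) (r * q).
Proof.
move=> pq i iN; rewrite !coefM; apply: eq_bigr => j _.
by rewrite pq // (leq_ltn_trans (leq_subr _ _)).
Qed.

Definition fps_poly (N : nat) (f : fps) : {poly R} := \poly_(i < N) (f i)%:~R.

Lemma fps_polyM N f g :
  eqX N (fps_poly N (fps_mul f g)) (fps_poly N f * fps_poly N g).
Proof.
move=> i iN; rewrite coef_poly iN coefM /fps_mul rmorph_sum /=.
apply: eq_bigr => j _; rewrite !coef_poly rmorphM.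
have jN : (j < N)%N by apply: leq_ltn_trans iN; rewrite -ltnS.
by rewrite jN (leq_ltn_trans (leq_subr _ _) iN).
Qed.

Lemma fps_poly1 N : eqX N (fps_poly N fps_one) 1.
Proof.
by move=> i iN; rewrite coef_poly iN coef1 /fps_one; case: (i == 0)%N.
Qed.

Lemma fps_poly_1subX N s : eqX N (fps_poly N (fps_1subX s)) (1 - 'X^s).
Proof.
move=> i iN; rewrite coef_poly iN coefB coef1 coefXn /fps_1subX rmorphB /=.
by case: (i == 0)%N; case: (i == s).
Qed.

Lemma geom_poly N s : (0 < s)%N ->
  eqX N ((1 - 'X^s) * fps_poly N (fps_geom s)) 1.
Proof.
move=> s_gt0; apply: eqX_trans _ (@fps_poly1 N); rewrite -(fps_geomP s_gt0).
apply: eqX_sym; apply: (eqX_trans (@fps_polyM _ _ _)).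
by rewrite mulrC [(1 - _) * _]mulrC; apply: eqXM; exact: fps_poly_1subX.
Qed.

Lemma geoms_poly N (s : seq nat) : all (fun z => 0 < z)%N s ->
  eqX N ((\prod_(z <- s) (1 - 'X^z))
         * fps_poly N (\big[fps_mul/fps_one]_(z <- s) fps_geom z)) 1.
Proof.
elim: s => [|z s IHs] /=; first by rewrite !big_nil mul1r => _; exact: fps_poly1.
case/andP => z_gt0 /IHs {}IHs; rewrite !big_cons.
apply: (eqX_trans (eqXM _ (@fps_polyM _ _ _))).
rewrite mulrACA mulrC; apply: (eqX_trans (eqXM _ (@geom_poly _ _ z_gt0))).
by rewrite mulr1.
Qed.

Definition binom_poly (N m : nat) : {poly R} := \poly_(i < N) 'C(i + m, m)%:R.

(** By Pascal's rule, multiplying by [1 - X] lowers [m] by one. *)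
Lemma binom_polyP N m : eqX N ((1 - 'X) ^+ m.+1 * binom_poly N m) 1.
Proof.
elim: m => [|m IHm].
  move=> i iN; rewrite expr1 mulrBl mul1r coefB mulrC coefMX !coef_poly iN.
  rewrite coef1; case: i iN => [|i] iN; rewrite /= !bin0 ?subr0 //.
  by rewrite (ltnW iN) subrr.
rewrite exprSr -mulrA; apply: eqX_trans _ IHm; apply: eqXM.
move=> i iN; rewrite mulrBl mul1r coefB mulrC coefMX !coef_poly iN.
case: i iN => [|i] iN /=; first by rewrite !binn subr0.
by rewrite (ltnW iN) [in RHS]addSnnS addSn binS natrD addrAC subrr add0r.
Qed.

End PowerSeries.

(** * Repunits and their expansions at 1 *)

Section Repunits.
Variable R : numFieldType.
Local Notation Y := (1 - 'X : {poly R}).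

Definition repunit (n : nat) : {poly R} := \sum_(i < n) 'X^i.

Lemma repunitE n : Y * repunit n = 1 - 'X^n.
Proof. by rewrite -[1 - 'X^n]opprB subrX1 -mulNr opprB. Qed.

Lemma Y_neq0 : Y != 0.
Proof. by rewrite -opprB oppr_eq0 polyXsubC_eq0. Qed.

Lemma repunitS n : repunit n.+1 = 1 + 'X * repunit n.
Proof.
by apply: (mulfI Y_neq0); rewrite mulrDr mulrCA !repunitE exprS; ring.
Qed.

Lemma dvdp_repunit m n : (m %| n)%N -> repunit m %| repunit n.
Proof.
case/dvdnP => q ->; apply/dvdpP; exists (\sum_(i < q) ('X^m) ^+ i).
apply: (mulfI Y_neq0); rewrite mulrCA !repunitE mulnC exprM.
by rewrite -[LHS]opprB subrX1 -mulNr opprB mulrC.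
Qed.

(** A relation [u m = v n + 1] lifts to the Bezout identity
    [repunit (u m) - X repunit (v n) = 1]. *)
Lemma coprimep_repunit m n : (0 < m)%N -> coprime m n ->
  coprimep (repunit m) (repunit n).
Proof.
move=> m_gt0 /(coprimeP _ m_gt0)[[u v] /= uv].
have uvE : (u * m = (v * n).+1)%N by lia.
have /dvdpP[p pE] := dvdp_repunit (dvdn_mull u (dvdnn m)).
have /dvdpP[q qE] := dvdp_repunit (dvdn_mull v (dvdnn n)).
apply/Bezout_coprimepP; exists (p, - 'X * q) => /=.
by rewrite !mulNr -mulrA -pE -qE uvE repunitS addrK eqpxx.
Qed.

Lemma dvdp_prod_repunit (s : seq nat) n :
  all (fun z => 0 < z)%N s -> pairwise coprime s ->
  all (fun z => z %| n)%N s -> \prod_(z <- s) repunit z %| repunit n.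
Proof.
elim: s => [|z s IHs] /=; first by rewrite big_nil dvd1p.
case/andP => z_gt0 s_gt0 /andP[z_s s_s] /andP[zn sn].
rewrite big_cons Gauss_dvdp; first by rewrite dvdp_repunit ?IHs.
rewrite big_seq; apply: (big_ind (coprimep _)) => [|p q|y ys].
- exact: coprimep1.
- by rewrite coprimepMr => -> ->.
- by rewrite coprimep_repunit // (allP z_s).
Qed.

(** The Taylor expansion at [X = 1], modulo [Y^4]. *)
Definition expands (p : {poly R}) (p0 p1 p2 p3 : R) : Prop :=
  exists r, p = p0%:P + p1%:P * Y + p2%:P * Y ^+ 2 + p3%:P * Y ^+ 3 + Y ^+ 4 * r.

Lemma expandsM p p0 p1 p2 p3 q q0 q1 q2 q3 :
  expands p p0 p1 p2 p3 -> expands q q0 q1 q2 q3 ->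
  expands (p * q) (p0 * q0) (p0 * q1 + p1 * q0) (p0 * q2 + p1 * q1 + p2 * q0)
    (p0 * q3 + p1 * q2 + p2 * q1 + p3 * q0).
Proof.
move=> [r ->] [s ->]; rewrite /expands !(polyCD, polyCM).
exists (p1%:P * q3%:P + p2%:P * q2%:P + p3%:P * q1%:P
  + (p2%:P * q3%:P + p3%:P * q2%:P) * Y + p3%:P * q3%:P * Y ^+ 2
  + (p0%:P + p1%:P * Y + p2%:P * Y ^+ 2 + p3%:P * Y ^+ 3) * s
  + (q0%:P + q1%:P * Y + q2%:P * Y ^+ 2 + q3%:P * Y ^+ 3) * r
  + Y ^+ 4 * r * s); ring.
Qed.

(** Since [repunit n] is [(1 - (1 - Y)^n) / Y], the coefficients are [(-1)^i C(n, i + 1)], and the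
    induction is Pascal's rule. *)
Lemma expands_repunit n : expands (repunit n) n%:R
  (- (n%:R * (n%:R - 1) / 2)) (n%:R * (n%:R - 1) * (n%:R - 2) / 6)
  (- (n%:R * (n%:R - 1) * (n%:R - 2) * (n%:R - 3) / 24)).
Proof.
elim: n => [|n [r rE]].
  by exists 0; rewrite /repunit big_ord0 !mul0r oppr0 !polyC0; ring.
have -> : n.+1%:R = n%:R + 1 :> R by rewrite natr1.
rewrite repunitS rE; set x : R := n%:R.
pose c := x * (x - 1) * (x - 2) * (x - 3) / 24.
(* Multiplying by [X = 1 - Y] turns the cubic term [- c Y^3] into an overflow [c Y^4]. *)
exists ((1 - Y) * r + c%:P).
have -> : (x + 1) * (x + 1 - 1) / 2 = x * (x - 1) / 2 + x by field.
have -> : (x + 1) * (x + 1 - 1) * (x + 1 - 2) / 6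
  = x * (x - 1) * (x - 2) / 6 + x * (x - 1) / 2 by field.
have -> : (x + 1) * (x + 1 - 1) * (x + 1 - 2) * (x + 1 - 3) / 24
  = c + x * (x - 1) * (x - 2) / 6 by rewrite /c; field.
rewrite -/c; move: (x * (x - 1) / 2) (x * (x - 1) * (x - 2) / 6) c => c1 c2 c3.
by rewrite !(polyCD, polyCN); ring.
Qed.

End Repunits.

(** * Partial fractions and the bounded error *)

Section QuasiPolynomial.
Variable R : realType.
Local Notation Y := (1 - 'X : {poly R}).

Lemma eqX_geom_bound (p : {poly R}) (m : nat) : exists M : R,
  forall n N, (n < N)%N -> `|(p * fps_poly R N (fps_geom m))`_n| <= M.
Proof.
exists (\sum_(j < size p) `|p`_j|) => n N nN.
rewrite -{1}[p]coefK poly_def mulr_suml coef_sum.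
apply: le_trans (ler_norm_sum _ _ _) (ler_sum _ _) => j _.
rewrite -scalerAl coefZ coefXnM; case: ltnP => _; first by rewrite mulr0 normr0.
rewrite normrM ler_piMr // coef_poly (leq_ltn_trans (leq_subr _ _) nN).
by rewrite /fps_geom; case: (_ %| _)%N; rewrite ?normr1 // normr0.
Qed.

(* With Y = 1 - X and W the product of the repunits, C W + Y^4 K = 1, so
   1 / (Y^5 W) = C / Y^5 + K / (Y W), and Y W divides some 1 - X^m. *)
Lemma part_series_bound (s : seq nat) (c0 c1 c2 c3 : R) :
  all (fun z => 0 < z)%N s -> pairwise coprime s -> size s = 5%N ->
  expands ((\prod_(z <- s) repunit R z)
    * (c0%:P + c1%:P * Y + c2%:P * Y ^+ 2 + c3%:P * Y ^+ 3)) 1 0 0 0 ->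
  exists M, forall n,
    `|((\big[fps_mul/fps_one]_(z <- s) fps_geom z) n)%:~R
      - (c0 * 'C(n + 4, 4)%:R + c1 * 'C(n + 3, 3)%:R
         + c2 * 'C(n + 2, 2)%:R + c3 * 'C(n + 1, 1)%:R)| <= M.
Proof.
move=> s_gt0 s_coprime size_s.
set W := \prod_(z <- s) _; set C := _ + _ * Y ^+ 3; set p := \big[_/_]_(_ <- _) _.
rewrite /expands !polyC0 !polyC1 !mul0r !addr0 => -[r CW].
pose m := \prod_(z <- s) z.
have m_gt0 : (0 < m)%N.
  by rewrite /m big_seq prodn_cond_gt0 // => z /(allP s_gt0).
have /dvdpP[V VE] : W %| repunit R m.
  apply: dvdp_prod_repunit => //; apply/allP => z zs.
  by rewrite /m (big_rem z) //= dvdn_mulr.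
have [M boundM] := eqX_geom_bound (- r * V) m; exists M => n.
pose N := n.+1; pose P := fps_poly R N p; pose g := fps_poly R N (fps_geom m).
pose T := c0%:P * binom_poly R N 4 + c1%:P * binom_poly R N 3
  + c2%:P * binom_poly R N 2 + c3%:P * binom_poly R N 1.
have DP : eqX N (P * (Y ^+ 5 * W)) 1.
  rewrite mulrC -size_s; apply: eqX_trans _ (@geoms_poly _ _ _ s_gt0).
  suff -> : Y ^+ size s * W = \prod_(z <- s) (1 - 'X^z) by [].
  rewrite /W; elim: (s) => [|z t IHt]; first by rewrite !big_nil mulr1.
  by rewrite !big_cons -IHt -repunitE /= exprS; ring.
have TP : eqX N (Y ^+ 5 * T) C.
  have scaleP q j : eqX N (q * (Y ^+ j.+1 * binom_poly R N j)) q.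
    by rewrite -[X in eqX _ _ X]mulr1; apply: eqXM; exact: binom_polyP.
  rewrite (_ : _ * _ = c0%:P * (Y ^+ 5 * binom_poly R N 4)
    + c1%:P * Y * (Y ^+ 4 * binom_poly R N 3)
    + c2%:P * Y ^+ 2 * (Y ^+ 3 * binom_poly R N 2)
    + c3%:P * Y ^+ 3 * (Y ^+ 2 * binom_poly R N 1)); last by rewrite /T; ring.
  by do ![apply: eqXD].
have gP : eqX N ((1 - 'X^m) * g) 1 by exact: geom_poly.
(* Here [P] splits as [P W C + P Y^4 (- r)]. In the first term [C] becomes [Y^5 T]; the second is
   multiplied by [(1 - X^m) g = Y V W g]. Both then contain [P Y^5 W], which is 1. *)
have PE : eqX N P (T + - r * V * g).
  have -> : P = P * (W * C) + P * (Y ^+ 4 * - r) by rewrite CW; ring.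
  apply: eqXD.
    apply: (eqX_trans (q := P * W * (Y ^+ 5 * T))).
      by rewrite mulrA; apply: eqXM; apply: eqX_sym.
    rewrite (_ : P * W * _ = T * (P * (Y ^+ 5 * W))); last by ring.
    by rewrite -[X in eqX _ _ X]mulr1; exact: eqXM.
  apply: (eqX_trans (q := P * (Y ^+ 4 * - r) * ((1 - 'X^m) * g))).
    by rewrite -[X in eqX _ X]mulr1; apply: eqXM; apply: eqX_sym.
  rewrite -repunitE VE.
  rewrite (_ : P * _ * _ = - r * V * g * (P * (Y ^+ 5 * W))); last by ring.
  by rewrite -[X in eqX _ _ X]mulr1; exact: eqXM.
have := PE n (ltnSn n); rewrite coefD coef_poly ltnSn => ->.
rewrite !coefD !coefCM !coef_poly ltnSn addrC addKr.
exact: boundM.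
Qed.

End QuasiPolynomial.

(** A finite set lists its elements in its own order, while [pairwise] depends on the order.
    Uniqueness keeps an element from being paired with itself. *)
Lemma perm_pairwise_coprime (s t : seq nat) :
  perm_eq s t -> uniq t -> pairwise coprime t -> pairwise coprime s.
Proof.
move=> st t_uniq t_coprime.
have coprime_in : {in t &, forall x y, x != y -> coprime x y}.
  elim: (t) t_coprime => [|z u IHu] //= /andP[/allP z_u /IHu {}IHu] x y.
  rewrite !inE => /predU1P[->|xu] /predU1P[->|yu] xy; first by rewrite eqxx in xy.
  - exact: z_u.
  - by rewrite coprime_sym z_u.
  - exact: IHu.
have : pairwise [rel x y | x != y] s by rewrite -uniq_pairwise (perm_uniq st).
apply: (sub_in_pairwise (P := mem t)); first exact: coprime_in.
by apply/allP => x; rewrite (perm_mem st).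
Qed.

(** * Five pairwise coprime parts *)

Section PartitionFunction.
Variables (R : realType) (z1 z2 z3 z4 z5 : nat).
Hypotheses (z_gt0 : all (fun z => 0 < z)%N [:: z1; z2; z3; z4; z5])
  (z_distinct : uniq [:: z1; z2; z3; z4; z5])
  (z_coprime : pairwise coprime [:: z1; z2; z3; z4; z5]).

Local Notation a := (coef_a R z1 z2 z3 z4 z5).
Local Notation b := (coef_b R z1 z2 z3 z4 z5).
Local Notation c := (coef_c R z1 z2 z3 z4 z5).
Local Notation d := (coef_d R z1 z2 z3 z4 z5).
Local Notation Y := (1 - 'X : {poly R}).

Let z_neq0 : [/\ z1%:R != 0 :> R, z2%:R != 0 :> R, z3%:R != 0 :> R,
  z4%:R != 0 :> R & z5%:R != 0 :> R].
Proof.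
by move: z_gt0 => /and5P[? ? ? ? /andP[? _]]; rewrite !pnatr_eq0 -!lt0n.
Qed.

Lemma coef_a_gt0 : 0 < a.
Proof.
move: z_gt0 => /and5P[? ? ? ? /andP[? _]].
by rewrite divr_gt0 // mulr_gt0 // ltr0n !muln_gt0; do !(apply/andP; split).
Qed.

(* The coefficient of Y^i is that of 'C(n + 4 - i, 4 - i) when a n^4 + b n^3
   + c n^2 + d n is expressed, up to a constant, in binomial coefficients. *)
Lemma expands_part : expands ((\prod_(z <- [:: z1; z2; z3; z4; z5]) repunit R z)
    * ((24 * a)%:P + (6 * b - 60 * a)%:P * Y
       + (2 * c - 12 * b + 50 * a)%:P * Y ^+ 2
       + (d - 3 * c + 7 * b - 15 * a)%:P * Y ^+ 3)) 1 0 0 0.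
Proof.
have expC p0 p1 p2 p3 : expands
  (p0%:P + p1%:P * Y + p2%:P * Y ^+ 2 + p3%:P * Y ^+ 3) p0 p1 p2 p3.
  by exists 0; rewrite mulr0 addr0.
have := expandsM (expandsM (expands_repunit R z1) (expandsM (expands_repunit R z2)
  (expandsM (expands_repunit R z3) (expandsM (expands_repunit R z4)
  (expands_repunit R z5))))) (expC (24 * a) (6 * b - 60 * a)
    (2 * c - 12 * b + 50 * a) (d - 3 * c + 7 * b - 15 * a)).
rewrite !big_cons big_nil mulr1.
rewrite /coef_a /coef_b /coef_c /coef_d !(natrD, natrM, natrX).
case: z_neq0; set x1 : R := z1%:R; set x2 : R := z2%:R; set x3 : R := z3%:R.
set x4 : R := z4%:R; set x5 : R := z5%:R => ? ? ? ? ?.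
set w0 := (X in expands _ X _ _ _); set w1 := (X in expands _ _ X _ _).
set w2 := (X in expands _ _ _ X _); set w3 := (X in expands _ _ _ _ X).
have -> : w0 = 1 by rewrite /w0; field; do !(apply/andP; split).
have -> : w1 = 0 by rewrite /w1; field; do !(apply/andP; split).
have -> : w2 = 0 by rewrite /w2; field; do !(apply/andP; split).
have -> // : w3 = 0 by rewrite /w3; field; do !(apply/andP; split).
Qed.

Lemma part_remainder_bounded : exists M, forall n,
  `|part_remainder R z1 z2 z3 z4 z5 n| <= M.
Proof.
pose s : seq nat := [fset z1; z2; z3; z4; z5]%fset.
have s_perm : perm_eq s [:: z1; z2; z3; z4; z5].
  apply: uniq_perm => [|//|z]; first exact: fset_uniq.
  by rewrite !inE -!orbA.
have s_gt0 : all (fun z => 0 < z)%N s by rewrite (perm_all _ s_perm).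
have s_coprime : pairwise coprime s.
  exact: perm_pairwise_coprime z_distinct z_coprime.
have [M boundM] := part_series_bound s_gt0 s_coprime (perm_size s_perm)
  (eq_ind_r (fun p => expands (p * _) 1 0 0 0) expands_part (perm_big _ s_perm)).
(* The constant by which the binomial form exceeds [a n^4 + ... + d n]: its value at [n = 0], where
   all binomials are 1. *)
pose h : R := 24 * a + (6 * b - 60 * a) + (2 * c - 12 * b + 50 * a)
  + (d - 3 * c + 7 * b - 15 * a).
exists (M + `|h|) => n; rewrite /part_remainder /part_series.
set p := _%:~R; set q := _ + d * _.
have := boundM n; rewrite -/p.
have -> : p - q = p - (q + h) + h by ring.
suff -> : q + h = 24 * a * 'C(n + 4, 4)%:R + (6 * b - 60 * a) * 'C(n + 3, 3)%:R
  + (2 * c - 12 * b + 50 * a) * 'C(n + 2, 2)%:R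
  + (d - 3 * c + 7 * b - 15 * a) * 'C(n + 1, 1)%:R.
  by move=> ?; rewrite (le_trans (ler_normD _ _)) // lerD2r.
have binE m k :
    'C(m + k, k)%:R = (\prod_(i < k) (m%:R + i.+1%:R)) / k`!%:R :> R.
  apply: (canRL (mulfK _)); first by rewrite pnatr_eq0 -lt0n fact_gt0.
  rewrite -natrM bin_ffact; elim: k => [|k IHk]; first by rewrite big_ord0.
  by rewrite addnS ffactSS natrM IHk big_ord_recr /= mulrC -addnS natrD.
rewrite !binE !big_ord_recr !big_ord0 /= /q /h !factS fact0.
by field.
Qed.

Lemma part_remainder_le n : `|part_remainder R z1 z2 z3 z4 z5 n|
  <= coef_e R z1 z2 z3 z4 z5.
Proof.
have [M boundM] := part_remainder_bounded.
apply: ub_le_sup; last by exists n.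
by exists M => _ [m _ <-].
Qed.

End PartitionFunction.

(** * The theorem *)

Section TailSum.
Variables (R : realType) (A B : R) (k : nat).
Hypotheses (AB_int : integer_valued A B) (B_ge0 : 0 <= B) (ltBA : B < A).

(* The integers outside [-k, k-1], ordered as k, -k-1, k+1, -k-2, and so on,
   that is by increasing exponents. *)
Definition tail_index (r : nat) : int :=
  if odd r then - (k + uphalf r)%:Z else (k + r./2)%:Z.

Lemma tail_index_double p : tail_index p.*2 = (k + p)%:Z.
Proof. by rewrite /tail_index odd_double doubleK. Qed.

Lemma tail_index_doubleS p : tail_index p.*2.+1 = - (k + p.+1)%:Z.
Proof. by rewrite /tail_index /= odd_double /= doubleK. Qed.

Definition tail_expo (r : nat) : nat := Num.truncn (quad A B (tail_index r)%:~R).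

Lemma quad_int_ge0 (j : int) : 0 <= quad A B j%:~R.
Proof.
have A_ge0 : 0 <= A by apply: le_trans (ltW ltBA).
rewrite /quad; case: j => m.
  by rewrite addr_ge0 // mulr_ge0 ?sqr_ge0 // ler0z.
set x : R := m.+1%:R; have x_ge1 : 1 <= x by rewrite ler1n.
rewrite NegzE mulrNz -/x sqrrN.
have -> : A * x ^+ 2 + B * - x = x * (A * (x - 1) + (A - B)) by ring.
have x_ge0 : 0 <= x by apply: le_trans x_ge1.
have AB_ge0 : 0 <= A - B by rewrite subr_ge0 ltW.
have x1_ge0 : 0 <= x - 1 by rewrite subr_ge0.
by rewrite mulr_ge0 // addr_ge0 // mulr_ge0.
Qed.

Lemma tail_expoE r : (tail_expo r)%:R = quad A B (tail_index r)%:~R.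
Proof. by rewrite truncnK // natrEint AB_int quad_int_ge0. Qed.

Lemma tail_expo_double p : (tail_expo p.*2 < tail_expo p.*2.+1)%N.
Proof.
rewrite -(ltr_nat R) !tail_expoE tail_index_double tail_index_doubleS.
rewrite mulrNz -!pmulrn /quad addnS -natr1; set x : R := (k + p)%:R.
rewrite -subr_gt0.
have -> : A * (- (x + 1)) ^+ 2 + B * - (x + 1) - (A * x ^+ 2 + B * x)
  = (A - B) * (2 * x + 1) by ring.
by rewrite mulr_gt0 ?subr_gt0 // ltr_wpDl // mulr_ge0.
Qed.

(** The gap is [2 B x], so for [B = 0] the two exponents coincide and the inequality is only
    weak. *)
Lemma tail_expo_doubleS p : (tail_expo p.*2.+1 <= tail_expo p.+1.*2)%N.
Proof.
rewrite -(ler_nat R) !tail_expoE tail_index_double tail_index_doubleS.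
rewrite mulrNz -!pmulrn /quad; set x : R := (k + p.+1)%:R.
have := mulr_ge0 B_ge0 (ler0n R (k + p.+1)); rewrite -/x sqrrN mulrN => ?.
by lra.
Qed.

Lemma tail_expo_mono : {homo tail_expo : r s / (r <= s)%N}.
Proof.
apply: (homo_leq leqnn leq_trans) => r; rewrite -(odd_double_half r).
case: (odd r) => /=; first by rewrite add1n tail_expo_doubleS.
by rewrite add0n ltnW ?tail_expo_double.
Qed.

Lemma tail_expo_unbounded n : (n <= tail_expo n.*2)%N.
Proof.
elim: n => // n IHn; apply: leq_trans (tail_expo_doubleS n).
exact: leq_ltn_trans (tail_expo_double n).
Qed.

Lemma tail_index_inj : injective tail_index.
Proof.
move=> r s; rewrite /tail_index.
by case: ifP => ?; case: ifP => ?; lia.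
Qed.

Lemma tail_indexP (j : int) :
  ~ (- k%:Z <= j <= k%:Z - 1) <-> exists r, j = tail_index r.
Proof.
split=> [|[r ->]]; last by rewrite /tail_index; case: ifP => ?; lia.
move=> /negP; case: (leP k%:Z j) => kj.
  by exists (absz (j - k%:Z)%R).*2; rewrite tail_index_double; lia.
move=> ?; exists (absz (- j - k%:Z - 1)%R).*2.+1.
by rewrite tail_index_doubleS; lia.
Qed.

Lemma sign_tail_index r : (-1 : int) ^ (tail_index r + k%:Z) = (-1) ^+ uphalf r.
Proof.
rewrite /tail_index; case: ifP => r_odd.
  by rewrite PoszD opprD addrAC addNr add0r -exprnN invr_sign.
rewrite -PoszD -exprnP addnAC addnn -mul2n exprD exprM sqrrN !expr1n mul1r.
by rewrite uphalf_half r_odd.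
Qed.

(** By monotonicity every index with exponent [m] is below [M]; several indices may share this
    exponent. *)
Lemma tail_seriesE (M m : nat) : (m < tail_expo M)%N ->
  tail_series A B k m = \sum_(r < M | tail_expo r == m) (-1) ^+ uphalf r.
Proof.
move=> mM; rewrite /tail_series.
pose s := [seq tail_index r | r <- iota 0 M & tail_expo r == m].
have s_uniq : uniq s.
  by rewrite map_inj_uniq ?filter_uniq ?iota_uniq //; exact: tail_index_inj.
have -> : tail_exponents A B k m = [set` s]%classic.
  apply/seteqP; split=> j /=.
    case=> /tail_indexP[r ->] /eqP; rewrite -tail_expoE eqr_nat => rm.
    rewrite map_f // mem_filter rm mem_iota /= add0n ltnNge.
    by apply/negP => /tail_expo_mono; rewrite (eqP rm) leqNgt mM.
  case/mapP => r; rewrite mem_filter => /andP[/eqP rm _] ->.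
  by split; [apply/tail_indexP; exists r|rewrite -tail_expoE rm].
rewrite -fsbig_seq // big_map big_filter -{1}[M]subn0.
rewrite -/(index_iota 0 M) big_mkord.
by apply: eq_bigr => r _; rewrite sign_tail_index.
Qed.

Lemma gammaE (S : {fset nat}) (T n : nat) :
  (forall r, (tail_expo r <= n)%N = (r < T)%N) ->
  gamma A B S k n =
  \sum_(r < T) (-1) ^+ uphalf r * part_series S (n - tail_expo r)%N.
Proof.
move=> T_P.
have nT : (n < tail_expo T)%N by rewrite ltnNge T_P ltnn.
rewrite /gamma /fps_mul.
under eq_bigr => i _.
  rewrite (tail_seriesE (M := T)); last by rewrite (leq_ltn_trans (leq_subr _ _)).
  rewrite big_mkcond mulr_sumr /=; over.
rewrite exchange_big /=; apply: eq_bigr => r _.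
have rn : (tail_expo r <= n)%N by rewrite T_P.
have rn1 : (n - tail_expo r < n.+1)%N by rewrite ltnS leq_subr.
rewrite (bigD1 (Ordinal rn1)) //= subKn // eqxx mulrC big1 ?addr0 // => i.
rewrite -val_eqE /= => ir; case: eqP => [E|_]; last by rewrite mulr0.
by move: ir; rewrite E subKn ?eqxx // -ltnS.
Qed.

(** Signs have period 4 in the index, with pattern + - - +, so indices [4 i], ..., [4 i + 3] form
    one block. *)
Lemma sum_blocks (g : R -> R) (l m : nat) (u : R) : (0 < m <= 4)%N ->
  \sum_(r < 4 * l + m) (-1) ^+ uphalf r * g (u - (tail_expo r)%:R)
  = altsum A B m g k%:R l u.
Proof.
pose F r := (-1) ^+ uphalf r * g (u - (tail_expo r)%:R).
have FE i : [/\ F (4 * i)%N = g (u - quad A B (k%:R + 2 * i%:R)),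
    F (4 * i + 1)%N = - g (u - quad A B (- (k%:R + 2 * i%:R) - 1)),
    F (4 * i + 2)%N = - g (u - quad A B (k%:R + 2 * i%:R + 1))
  & F (4 * i + 3)%N = g (u - quad A B (- (k%:R + 2 * i%:R) - 2))].
  have oddE j : odd (4 * i + j) = odd j by lia.
  have uphalfE j : uphalf (4 * i + j) = (2 * i + uphalf j)%N by lia.
  have halfE j : (4 * i + j)./2 = (2 * i + j./2)%N by lia.
  have signE j : (-1) ^+ (2 * i + j) = (-1) ^+ j :> R.
    by rewrite exprD exprM sqrrN expr1n expr1n mul1r.
  rewrite /F !tail_expoE /tail_index -[(4 * i)%N in X in [/\ X, _, _ & _]]addn0.
  rewrite !oddE !uphalfE !halfE !signE /= expr0 expr1 expr2.
  rewrite !mulN1r opprK !mul1r !mulrNz -!pmulrn !natrD.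
  by split; [|congr (- _)|congr (- _)|];
    congr (g (u - quad _ _ _)); ring.
have sum4 h : \sum_(r < 4 * h) F r = \sum_(i < h) block A B g (k%:R + 2 * i%:R) u.
  elim: h => [|h IHh]; first by rewrite !big_ord0.
  rewrite [RHS]big_ord_recr -IHh mulnS addnC !addnS addn0 !big_ord_recr /=.
  have [E0 E1 E2 E3] := FE h; rewrite !addnS addn0 in E1 E2 E3.
  by rewrite E0 E1 E2 E3 /block; ring.
have [E0 E1 E2 E3] := FE l; rewrite !addnS addn0 in E1 E2 E3.
rewrite (_ : \sum_(r < _) _ = \sum_(r < 4 * l + m) F r) // /altsum -sum4.
case: m => [|[|[|[|[|m]]]]] // _;
  rewrite !addnS addn0 !big_ord_recr /rest /= ?E0 ?E1 ?E2 ?E3 /block; ring.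
Qed.

End TailSum.

(** The four lower bounds in uniform shape: [u] lies between the exponents of the last index counted
    and of the first one not counted. *)
Lemma altsum_ge (R : realType) (A B a b c d e : R) (k l m : nat) (u : R) :
  0 < a -> 0 <= B -> B < A -> (1 <= k)%N -> (0 < m <= 4)%N ->
  max_root (Gs A B k%:R a b c d e) <= l%:R ->
  quad A B (tail_index k (4 * l + m.-1))%:~R <= u
    < quad A B (tail_index k (4 * l + m))%:~R ->
  (4 * l + m)%:R * e <= altsum A B m (quartic a b c d) k%:R l u.
Proof.
move=> a_gt0 B_ge0 ltBA k_ge1 m_le4 le_l.
have k_ge1R : 1 <= k%:R :> R by rewrite ler1n.
have Gl := Gs_ge0 a_gt0 B_ge0 ltBA k_ge1R le_l.
have oddE j : odd (4 * l + j) = odd j by lia.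
have uphalfE j : uphalf (4 * l + j) = (2 * l + uphalf j)%N by lia.
have halfE j : (4 * l + j)./2 = (2 * l + j./2)%N by lia.
rewrite /tail_index !oddE !uphalfE !halfE.
have natE j : (k + (2 * l + j))%:R = k%:R + 2 * l%:R + j%:R :> R.
  by rewrite natrD (natrD _ (2 * l)%N) natrM addrA.
have NnatE j : - (k + (2 * l + j))%:R = - (k%:R + 2 * l%:R) - j%:R :> R.
  by rewrite natE opprD.
rewrite (natrD _ (4 * l)%N) natrM; case: m m_le4 => [|[|[|[|[|m]]]]] // _ /=;
  rewrite ?mulrNz -!pmulrn ?NnatE ?natE ?addr0 => /andP[le_u lt_u].
- by apply: altsum1_ge => //; rewrite Gl // !inE eqxx ?orbT.
- by apply: altsum2_ge => //; rewrite ?Gl // !inE eqxx ?orbT.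
- by apply: altsum3_ge; rewrite ?le_u // Gl // !inE eqxx ?orbT.
- by apply: altsum4_ge; rewrite ?le_u // Gl // !inE eqxx ?orbT.
Qed.

Theorem theorem2p2 (R : realType) (A B : R) (k z1 z2 z3 z4 z5 : nat)
    (AB_int : integer_valued A B) (B_ge0 : 0 <= B) (ltBA : B < A)
    (k_ge1 : (1 <= k)%N)
    (z_gt0 : all (fun z => 0 < z)%N [:: z1; z2; z3; z4; z5])
    (z_distinct : uniq [:: z1; z2; z3; z4; z5])
    (z_coprime : pairwise coprime [:: z1; z2; z3; z4; z5]) (n : nat) :
  threshold_N A B k z1 z2 z3 z4 z5 <= n%:R ->
  0 <= gamma A B [fset z1; z2; z3; z4; z5]%fset k n.
Proof.
rewrite /threshold_N.
(* A negative threshold is impossible because [max_root] is at least 1. *)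
case LE : (threshold_L _ _ _ _ _ _ _ _) => [L|L] le_n; last first.
  have : 1 <= (Negz L)%:~R :> R.
    by rewrite -LE; apply: le_trans (ceil_ge _); exact: max_root_ge1.
  by rewrite ler1z.
pose E := tail_expo A B k.
(* Index [4 L] stands for the integer [k + 2 L], so its exponent is exactly the threshold. *)
have expo_L : (E (4 * L) <= n)%N.
  rewrite -(ler_nat R) tail_expoE // (_ : 4 * L = (2 * L).*2)%N; last by lia.
  by rewrite tail_index_double -pmulrn natrD natrM.
have ltE : exists r, (n < E r)%N.
  exists n.+1.*2; exact: tail_expo_unbounded.
case: (ex_minnP ltE) => T ltT minT.
have ET r : (E r <= n)%N = (r < T)%N.
  apply/idP/idP => [le_r|lt_r].
    rewrite ltnNge; apply/negP => /(tail_expo_mono k AB_int B_ge0 ltBA) le_Tr.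
    by move: (leq_trans ltT le_Tr); rewrite ltnNge le_r.
  by rewrite leqNgt; apply/negP => /minT; rewrite leqNgt lt_r.
rewrite (gammaE AB_int B_ge0 ltBA _ ET).
have ltLT : (4 * L < T)%N by rewrite -ET.
(* Dividing [T - 1] rather than [T] puts [m] in 1, ..., 4, and [4 L <= T - 1] gives [L <= l]. *)
pose l := (T.-1 %/ 4)%N; pose m := (T.-1 %% 4).+1.
have TE : T = (4 * l + m)%N by rewrite /l /m addnS mulnC -divn_eq prednK //; lia.
have m_le4 : (0 < m <= 4)%N by rewrite /m ltn_mod.
have le_Ll : (L <= l)%N by rewrite /l leq_divRL //; lia.
pose e := coef_e R z1 z2 z3 z4 z5.
pose f := quartic (coef_a R z1 z2 z3 z4 z5) (coef_b R z1 z2 z3 z4 z5)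
  (coef_c R z1 z2 z3 z4 z5) (coef_d R z1 z2 z3 z4 z5).
have le_sum : T%:R * e <= \sum_(r < T) (-1) ^+ uphalf r * f (n%:R - (E r)%:R).
  rewrite TE sum_blocks //; apply: altsum_ge => //.
  - exact: coef_a_gt0.
  - apply: le_trans (ceil_ge _) _.
    by rewrite -/(threshold_L A B k z1 z2 z3 z4 z5) LE -pmulrn ler_nat.
  - rewrite -!(tail_expoE k AB_int B_ge0 ltBA) ler_nat ltr_nat -TE.
    by rewrite -/E ltT ET andbT TE; lia.
rewrite -(ler0z R) rmorph_sum /=.
(* Each of the [T] terms loses at most [e] when the partition coefficient replaces [f]. *)
apply: le_trans (_ : _ <= \sum_(r < T)
  ((-1) ^+ uphalf r * f (n%:R - (E r)%:R) - e)) _.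
  by rewrite sumrB sumr_const card_ord -[e *+ T]mulr_natl subr_ge0.
apply: ler_sum => r _.
have rn : (E r <= n)%N by rewrite ET.
have := part_remainder_le R z_gt0 z_distinct z_coprime (n - E r).
rewrite /part_remainder natrB // rmorphM rmorphXn rmorphN1 /= => le_e.
rewrite lerBlDr -lerBlDl -mulrBr (le_trans (ler_norm _)) //.
by rewrite normrM normrX normrN1 expr1n mul1r distrC.
Qed.
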